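(* Let $n\ge 2$ be an integer, let $(\mathcal{A},\mathcal{E})$ be a Frobenius exact category, let $T\colon\mathcal{A}\to\mathcal{A}$ be an additive autoequivalence, and let $\omega\colon\mathrm{Id}_{\mathcal{A}}\to T$ be a natural transformation with $\omega_{T(X)}=T(\omega_X)$ for every object $X\in\mathcal{A}$. Then the stable category of the Frobenius exact category $(\mathrm{Fact}_n(\mathcal{A},T,\omega),\tilde{\mathcal{E}})$ is a triangulated category.
   Context: **Factorizations.** An $n$-fold $(\mathcal{A},T)$-factorization $X=(X^j,d_X^j)$ of $\omega$ is a sequence $X^0\xrightarrow{d_X^0}X^1\xrightarrow{d_X^1}\cdots\xrightarrow{d_X^{n-2}}X^{n-1}\xrightarrow{d_X^{n-1}}T(X^0)$ in $\mathcal{A}$ such that $d_X^{n-1}\circ\cdots\circ d_X^0=\omega_{X^0}$, and $T(d_X^{j-1})\circ\cdots\circ T(d_X^0)\circ d_X^{n-1}\circ\cdots\circ d_X^{j}=\omega_{X^j}$ for $1\le j\le n-1$. A morphism $f\colon X\to Y$ is a sequence $(f^0,\dots,f^{n-1})$ of morphisms $f^j\colon X^j\to Y^j$ in $\mathcal{A}$ with $f^{j+1}d_X^j=d_Y^jf^j$ for $0\le j\le n-2$ and $T(f^0)d_X^{n-1}=d_Y^{n-1}f^{n-1}$. With componentwise composition and addition these form the additive category $\mathrm{Fact}_n(\mathcal{A},T,\omega)$. **Exact structures.** Exact categories are in the sense of Quillen: a class $\mathcal{E}$ of kernel-cokernel pairs (conflations), closed under isomorphism, satisfying Quillen's axioms.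 An exact category is Frobenius if it has enough projectives and enough injectives (relative to its conflations) and the projective objects coincide with the injective objects. $\tilde{\mathcal{E}}$ is the class of composable pairs $(l,p)$ of morphisms in $\mathrm{Fact}_n(\mathcal{A},T,\omega)$ such that $(l^j,p^j)\in\mathcal{E}$ for all $0\le j\le n-1$. The stable category of a Frobenius exact category has the same objects, and its morphisms are the morphisms modulo those factoring through a projective (equivalently injective) object; its triangulated structure is the standard one (suspension given by cosyzygies, i.e. cokernels of inflations into injective objects, and distinguished triangles induced by conflations).
   Formalization: For a mere additive autoequivalence T, Fact_n is exact but need not be Frobenius (swap on a product with two exact structures). Proved: it is exact; it is Frobenius if T preserves and reflects conflations; whenever it is Frobenius, its stable category is triangulated. *)

(* Defs.v *)
From HB Require Import structures.
From mathcomp Require Import all_boot all_algebra generic_quotient ring_quotient.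
From mathcomp Require Import boolp.

Set Implicit Arguments.
Unset Strict Implicit.
Unset Printing Implicit Defensive.

Import GRing.Theory.
Local Open Scope ring_scope.
Local Open Scope quotient_scope.

Record preadditive := Preadditive {
  ob :> Type;
  hom : ob -> ob -> zmodType;
  idm : forall X, hom X X;
  compm : forall X Y Z, hom Y Z -> hom X Y -> hom X Z;
  compmA : forall W X Y Z (h : hom Y Z) (g : hom X Y) (f : hom W X),
    compm h (compm g f) = compm (compm h g) f;
  comp1m : forall X Y (f : hom X Y), compm (idm Y) f = f;
  compm1 : forall X Y (f : hom X Y), compm f (idm X) = f;
  compmDl : forall X Y Z (g h : hom Y Z) (f : hom X Y),
    compm (g + h) f = compm g f + compm h f;
  compmDr : forall X Y Z (h : hom Y Z) (f g : hom X Y),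
    compm h (f + g) = compm h f + compm h g }.

Arguments hom {_} _ _.
Arguments idm {_} _.
Arguments compm {_ _ _ _} _ _.

Notation "g \oc f" := (compm g f) (at level 40, left associativity).

Lemma comp0m (A : preadditive) (X Y Z : A) (f : hom X Y) :
  (0 : hom Y Z) \oc f = 0.
Proof. by apply: (addrI ((0 : hom Y Z) \oc f)); rewrite -compmDl !addr0. Qed.

Lemma compm0 (A : preadditive) (X Y Z : A) (f : hom Y Z) :
  f \oc (0 : hom X Y) = 0.
Proof. by apply: (addrI (f \oc (0 : hom X Y))); rewrite -compmDr !addr0. Qed.

Lemma compmN (A : preadditive) (X Y Z : A) (g : hom Y Z) (f : hom X Y) :
  g \oc (- f) = - (g \oc f).
Proof.
by apply: (addrI (g \oc f)); rewrite -compmDr !subrr compm0.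
Qed.

Lemma compNm (A : preadditive) (X Y Z : A) (g : hom Y Z) (f : hom X Y) :
  (- g) \oc f = - (g \oc f).
Proof.
by apply: (addrI (g \oc f)); rewrite -compmDl !subrr comp0m.
Qed.

Definition is_iso (A : preadditive) (X Y : A) (f : hom X Y) : Prop :=
  exists g : hom Y X, g \oc f = idm X /\ f \oc g = idm Y.

Definition is_zero_object (A : preadditive) (Z : A) : Prop :=
  (forall X (f g : hom X Z), f = g) /\ (forall X (f g : hom Z X), f = g).

Definition is_biproduct (A : preadditive) (X Y S : A)
    (i1 : hom X S) (i2 : hom Y S) (p1 : hom S X) (p2 : hom S Y) : Prop :=
  [/\ p1 \oc i1 = idm X, p2 \oc i2 = idm Y, p1 \oc i2 = 0, p2 \oc i1 = 0
    & i1 \oc p1 + i2 \oc p2 = idm S].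

Definition is_additive (A : preadditive) : Prop :=
  (exists Z : A, is_zero_object Z) /\
  (forall X Y : A, exists S (i1 : hom X S) (i2 : hom Y S)
     (p1 : hom S X) (p2 : hom S Y), is_biproduct i1 i2 p1 p2).

Record functor (A B : preadditive) := Functor {
  fob :> A -> B;
  fmap : forall X Y, hom X Y -> hom (fob X) (fob Y);
  fmap1 : forall X, fmap (idm X) = idm (fob X);
  fmapM : forall X Y Z (g : hom Y Z) (f : hom X Y),
    fmap (g \oc f) = fmap g \oc fmap f }.

Arguments fmap {_ _} _ {_ _} _.

Definition is_additive_functor (A B : preadditive) (F : functor A B) : Prop :=
  forall (X Y : A) (f g : hom X Y), fmap F (f + g) = fmap F f + fmap F g.

Definition id_functor (A : preadditive) : functor A A :=
  @Functor A A id (fun _ _ f => f) (fun _ => erefl) (fun _ _ _ _ _ => erefl).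

Section FunctorComp.
Variables (A B C : preadditive) (G : functor B C) (F : functor A B).

Let gf_map (X Y : A) (f : hom X Y) : hom (G (F X)) (G (F Y)) := fmap G (fmap F f).

Fact comp_functor1 X : gf_map (idm X) = idm (G (F X)).
Proof. by rewrite /gf_map !fmap1. Qed.

Fact comp_functorM X Y Z (g : hom Y Z) (f : hom X Y) :
  gf_map (g \oc f) = gf_map g \oc gf_map f.
Proof. by rewrite /gf_map !fmapM. Qed.

Definition comp_functor : functor A C := Functor comp_functor1 comp_functorM.
End FunctorComp.

Record nat_trans (A B : preadditive) (F G : functor A B) := NatTrans {
  ntc :> forall X, hom (F X) (G X);
  nt_natural : forall X Y (f : hom X Y), ntc Y \oc fmap F f = fmap G f \oc ntc X }.

Definition nat_isomorphic (A B : preadditive) (F G : functor A B) : Prop :=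
  exists a : nat_trans F G, forall X, is_iso (a X).

Definition is_equivalence (A B : preadditive) (F : functor A B) : Prop :=
  exists G : functor B A,
    nat_isomorphic (comp_functor G F) (id_functor A) /\
    nat_isomorphic (comp_functor F G) (id_functor B).

Section Exact.
Variable A : preadditive.

Definition is_kernel (X Y Z : A) (k : hom X Y) (g : hom Y Z) : Prop :=
  g \oc k = 0 /\
  (forall W (t : hom W Y), g \oc t = 0 -> exists! s : hom W X, k \oc s = t).

Definition is_cokernel (X Y Z : A) (f : hom X Y) (c : hom Y Z) : Prop :=
  c \oc f = 0 /\
  (forall W (t : hom Y W), t \oc f = 0 -> exists! s : hom Z W, s \oc c = t).

Definition is_pushout (X Y X' Y' : A)
    (i : hom X Y) (f : hom X X') (f' : hom Y Y') (i' : hom X' Y') : Prop :=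
  f' \oc i = i' \oc f /\
  (forall W (u : hom Y W) (v : hom X' W), u \oc i = v \oc f ->
     exists! s : hom Y' W, s \oc f' = u /\ s \oc i' = v).

Definition is_pullback (Y Z Y' Z' : A)
    (p : hom Y Z) (f : hom Z' Z) (f' : hom Y' Y) (p' : hom Y' Z') : Prop :=
  p \oc f' = f \oc p' /\
  (forall W (u : hom W Y) (v : hom W Z'), p \oc u = f \oc v ->
     exists! s : hom W Y', f' \oc s = u /\ p' \oc s = v).

Definition pair_class := forall X Y Z : A, hom X Y -> hom Y Z -> Prop.

Variable E : pair_class.

Definition inflation (X Y : A) (i : hom X Y) : Prop :=
  exists Z (p : hom Y Z), E i p.

Definition deflation (Y Z : A) (p : hom Y Z) : Prop :=
  exists X (i : hom X Y), E i p.

(** Quillen's axioms in Buehler's equivalent form, which omits the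
    redundant "obscure" axiom. *)
Record is_exact : Prop := IsExact {
  exact_additive : is_additive A;
  exact_ker : forall X Y Z (i : hom X Y) (p : hom Y Z), E i p -> is_kernel i p;
  exact_coker : forall X Y Z (i : hom X Y) (p : hom Y Z), E i p -> is_cokernel i p;
  exact_iso : forall (X Y Z X' Y' Z' : A) (i : hom X Y) (p : hom Y Z)
      (i' : hom X' Y') (p' : hom Y' Z')
      (a : hom X X') (b : hom Y Y') (c : hom Z Z'),
    is_iso a -> is_iso b -> is_iso c ->
    b \oc i = i' \oc a -> c \oc p = p' \oc b -> E i p -> E i' p';
  exact_infl1 : forall X : A, inflation (idm X);
  exact_defl1 : forall X : A, deflation (idm X);
  exact_inflM : forall X Y Z (j : hom Y Z) (i : hom X Y),
    inflation i -> inflation j -> inflation (j \oc i);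
  exact_deflM : forall X Y Z (q : hom Y Z) (p : hom X Y),
    deflation p -> deflation q -> deflation (q \oc p);
  exact_pushout : forall X Y X' (i : hom X Y) (f : hom X X'), inflation i ->
    exists Y' (f' : hom Y Y') (i' : hom X' Y'),
      is_pushout i f f' i' /\ inflation i';
  exact_pullback : forall Y Z Z' (p : hom Y Z) (f : hom Z' Z), deflation p ->
    exists Y' (f' : hom Y' Y) (p' : hom Y' Z'),
      is_pullback p f f' p' /\ deflation p' }.

Definition projective (P : A) : Prop :=
  forall Y Z (p : hom Y Z), deflation p ->
  forall f : hom P Z, exists g : hom P Y, p \oc g = f.

Definition injective_ob (I : A) : Prop :=
  forall X Y (i : hom X Y), inflation i ->
  forall f : hom X I, exists g : hom Y I, g \oc i = f.

Record is_frobenius : Prop := IsFrobenius {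
  frobenius_exact : is_exact;
  enough_projectives : forall X, exists P (p : hom P X), projective P /\ deflation p;
  enough_injectives : forall X, exists I (i : hom X I), injective_ob I /\ inflation i;
  projective_injective : forall P, projective P <-> injective_ob P }.

Definition factors_projective (X Y : A) (f : hom X Y) : Prop :=
  exists P (h : hom P Y) (g : hom X P), projective P /\ f = h \oc g.

Lemma zero_projective Z : is_zero_object Z -> projective Z.
Proof. by move=> [_ Z0] Y W p _ f; exists 0; apply: Z0. Qed.

Lemma biproduct_projective (P Q S : A) (i1 : hom P S) (i2 : hom Q S)
    (p1 : hom S P) (p2 : hom S Q) :
  is_biproduct i1 i2 p1 p2 -> projective P -> projective Q -> projective S.
Proof.
move=> [_ _ _ _ S1] hP hQ Y Z p hp f.
have [g1 e1] := hP _ _ p hp (f \oc i1); have [g2 e2] := hQ _ _ p hp (f \oc i2).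
exists (g1 \oc p1 + g2 \oc p2).
by rewrite compmDr !compmA e1 e2 -!compmA -compmDr S1 compm1.
Qed.

Lemma factors_projectiveB X Y (f g : hom X Y) : is_additive A ->
  factors_projective f -> factors_projective g -> factors_projective (f - g).
Proof.
move=> [_ hS] [P [hf [gf [hP ->]]]] [Q [hg [gg [hQ ->]]]].
have [S [i1 [i2 [p1 [p2 hb]]]]] := hS P Q.
exists S, (hf \oc p1 - hg \oc p2), (i1 \oc gf + i2 \oc gg); split.
  exact: biproduct_projective hb hP hQ.
have [e11 e22 e12 e21 _] := hb.
rewrite compmDr !compmDl !compNm -!compmA.
rewrite !(compmA p1) !(compmA p2) e11 e22 e12 e21 !comp1m !comp0m !compm0.
by rewrite oppr0 addr0 add0r.
Qed.

Lemma factors_projective_compl X Y Z (g : hom Y Z) (f : hom X Y) :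
  factors_projective f -> factors_projective (g \oc f).
Proof. by move=> [P [h [k [hP ->]]]]; exists P, (g \oc h), k; rewrite compmA. Qed.

Lemma factors_projective_compr X Y Z (g : hom Y Z) (f : hom X Y) :
  factors_projective g -> factors_projective (g \oc f).
Proof. by move=> [P [h [k [hP ->]]]]; exists P, h, (k \oc f); rewrite compmA. Qed.

End Exact.

Section Stable.
Variables (A : preadditive) (E : pair_class A) (hF : is_frobenius E).

Definition proj_ideal (X Y : A) : pred (hom X Y) :=
  [pred f | `[< factors_projective E f >]].

Fact proj_ideal_zmod (X Y : A) : zmod_closed (@proj_ideal X Y).
Proof.
have hA := exact_additive (frobenius_exact hF).
split=> [|f g]; last first.
  by rewrite !inE => /asboolP hf /asboolP hg; apply/asboolP/factors_projectiveB.
rewrite inE; apply/asboolP; have [[Z hZ] _] := hA.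
by exists Z, 0, 0; split; [exact: zero_projective | rewrite comp0m].
Qed.

Definition proj_zmodClosed (X Y : A) : zmodClosed (hom X Y) :=
  HB.pack (@proj_ideal X Y)
    (GRing.isZmodClosed.Build (hom X Y) (@proj_ideal X Y) (@proj_ideal_zmod X Y)).

Definition stable_hom (X Y : A) : zmodType := Quotient.quot (proj_zmodClosed X Y).

Definition stable_class (X Y : A) (f : hom X Y) : stable_hom X Y := \pi f.

Lemma stable_classP (X Y : A) (f g : hom X Y) :
  stable_class f = stable_class g <-> factors_projective E (f - g).
Proof.
rewrite /stable_class; split=> [/eqP|h]; last apply/eqP.
  by rewrite -Quotient.idealrBE => /asboolP.
by rewrite -Quotient.idealrBE; apply/asboolP.
Qed.

Lemma stable_classD (X Y : A) (f g : hom X Y) :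
  stable_class (f + g) = stable_class f + stable_class g.
Proof. by rewrite /stable_class raddfD. Qed.

Definition stable_comp (X Y Z : A) (g : stable_hom Y Z) (f : stable_hom X Y) :
    stable_hom X Z :=
  stable_class (repr g \oc repr f).

Lemma stable_compE (X Y Z : A) (g : hom Y Z) (f : hom X Y) :
  stable_comp (stable_class g) (stable_class f) = stable_class (g \oc f).
Proof.
have hr (U V : A) (h : hom U V) : factors_projective E (repr (stable_class h) - h).
  by apply/stable_classP; rewrite /stable_class reprK.
apply/stable_classP; set g' := repr _; set f' := repr _.
have -> : g' \oc f' - g \oc f = g' \oc (f' - f) - (g - g') \oc f.
  by rewrite compmDr compmN compmDl compNm opprD opprK addrA addrAC addrNK addrC.
apply: factors_projectiveB; first exact: exact_additive (frobenius_exact hF).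
  exact/factors_projective_compl/hr.
apply: factors_projective_compr; apply/stable_classP.
by rewrite /stable_class reprK.
Qed.

Lemma stable_homP (X Y : A) (P : stable_hom X Y -> Prop) :
  (forall f, P (stable_class f)) -> forall f, P f.
Proof. by move=> hP f; rewrite -[f]reprK; apply: hP. Qed.

Fact stable_compA (W X Y Z : A) (h : stable_hom Y Z) (g : stable_hom X Y)
    (f : stable_hom W X) :
  stable_comp h (stable_comp g f) = stable_comp (stable_comp h g) f.
Proof.
elim/stable_homP: h => h; elim/stable_homP: g => g; elim/stable_homP: f => f.
by rewrite !stable_compE compmA.
Qed.

Fact stable_comp1m (X Y : A) (f : stable_hom X Y) :
  stable_comp (stable_class (idm Y)) f = f.
Proof. by elim/stable_homP: f => f; rewrite stable_compE comp1m. Qed.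

Fact stable_compm1 (X Y : A) (f : stable_hom X Y) :
  stable_comp f (stable_class (idm X)) = f.
Proof. by elim/stable_homP: f => f; rewrite stable_compE compm1. Qed.

Fact stable_compDl (X Y Z : A) (g h : stable_hom Y Z) (f : stable_hom X Y) :
  stable_comp (g + h) f = stable_comp g f + stable_comp h f.
Proof.
elim/stable_homP: g => g; elim/stable_homP: h => h; elim/stable_homP: f => f.
by rewrite -stable_classD !stable_compE -stable_classD compmDl.
Qed.

Fact stable_compDr (X Y Z : A) (h : stable_hom Y Z) (f g : stable_hom X Y) :
  stable_comp h (f + g) = stable_comp h f + stable_comp h g.
Proof.
elim/stable_homP: g => g; elim/stable_homP: h => h; elim/stable_homP: f => f.
by rewrite -stable_classD !stable_compE -stable_classD compmDr.
Qed.

Definition stable : preadditive :=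
  Preadditive stable_compA stable_comp1m stable_compm1 stable_compDl stable_compDr.

Definition stable_mor (X Y : A) (f : hom X Y) : @hom stable X Y := stable_class f.

(** [S] is the suspension computed from a choice of conflations
    [X -> susp_inj X -> S X] with injective middle term. *)
Record cosyzygy_suspension (S : functor stable stable) := CosyzygySuspension {
  susp_inj : A -> A;
  susp_i : forall X : A, hom X (susp_inj X);
  susp_p : forall X : A, @hom A (susp_inj X) (S X);
  susp_injective : forall X, injective_ob E (susp_inj X);
  susp_conflation : forall X, E (susp_i X) (susp_p X);
  susp_fmap : forall (X Y : A) (f : hom X Y) (h : hom (susp_inj X) (susp_inj Y))
      (g : @hom A (S X) (S Y)),
    h \oc susp_i X = susp_i Y \oc f -> g \oc susp_p X = susp_p Y \oc h ->
    fmap S (stable_mor f) = stable_mor g }.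

End Stable.

Arguments stable_mor {_ _} _ {_ _} _.

Section Triangulated.
Variables (C : preadditive) (S : functor C C).

Definition triangle_class := forall X Y Z : C,
  hom X Y -> hom Y Z -> hom Z (S X) -> Prop.

Definition triangle_morphism (X Y Z X' Y' Z' : C)
    (f : hom X Y) (g : hom Y Z) (h : hom Z (S X))
    (f' : hom X' Y') (g' : hom Y' Z') (h' : hom Z' (S X'))
    (a : hom X X') (b : hom Y Y') (c : hom Z Z') : Prop :=
  [/\ b \oc f = f' \oc a, c \oc g = g' \oc b & fmap S a \oc h = h' \oc c].

Record is_triangulated (D : triangle_class) : Prop := IsTriangulated {
  tr_additive : is_additive C;
  tr_susp_additive : is_additive_functor S;
  tr_susp_equivalence : is_equivalence S;
  tr_iso : forall (X Y Z X' Y' Z' : C)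
      (f : hom X Y) (g : hom Y Z) (h : hom Z (S X))
      (f' : hom X' Y') (g' : hom Y' Z') (h' : hom Z' (S X'))
      (a : hom X X') (b : hom Y Y') (c : hom Z Z'),
    is_iso a -> is_iso b -> is_iso c -> triangle_morphism f g h f' g' h' a b c ->
    D X Y Z f g h -> D X' Y' Z' f' g' h';
  tr_id : forall X Z : C, is_zero_object Z -> D X X Z (idm X) 0 0;
  tr_cone : forall (X Y : C) (f : hom X Y), exists Z (g : hom Y Z) h, D X Y Z f g h;
  tr_rotate : forall (X Y Z : C) (f : hom X Y) (g : hom Y Z) (h : hom Z (S X)),
    D X Y Z f g h <-> D Y Z (S X) g h (- fmap S f);
  tr_fill : forall (X Y Z X' Y' Z' : C)
      (f : hom X Y) (g : hom Y Z) (h : hom Z (S X))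
      (f' : hom X' Y') (g' : hom Y' Z') (h' : hom Z' (S X'))
      (a : hom X X') (b : hom Y Y'),
    D X Y Z f g h -> D X' Y' Z' f' g' h' -> b \oc f = f' \oc a ->
    exists c : hom Z Z', triangle_morphism f g h f' g' h' a b c;
  tr_octahedron : forall (X Y Z Z' X' Y' : C) (f : hom X Y) (g : hom Y Z)
      (i : hom Y Z') (i' : hom Z' (S X))
      (j : hom Z X') (j' : hom X' (S Y))
      (k : hom Z Y') (k' : hom Y' (S X)),
    D X Y Z' f i i' -> D Y Z X' g j j' -> D X Z Y' (g \oc f) k k' ->
    exists (u : hom Z' Y') (v : hom Y' X'),
      [/\ D Z' Y' X' u v (fmap S i \oc j'),
          u \oc i = k \oc g, k' \oc u = i', v \oc k = j
        & j' \oc v = fmap S f \oc k'] }.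

End Triangulated.

(** The triangles isomorphic to some [X -> Y -> Z -> S X] coming from a
    conflation [(i, p)], where [w] is induced by a morphism of conflations
    from [(i, p)] to the chosen one on [X] extending the identity of [X]. *)
Definition stable_triangle (A : preadditive) (E : pair_class A)
    (hF : is_frobenius E) (S : functor (stable hF) (stable hF))
    (sD : cosyzygy_suspension S) : triangle_class S :=
  fun X Y Z f g h =>
  exists (X' Y' Z' : A) (i : hom X' Y') (p : hom Y' Z')
    (u : hom Y' (susp_inj sD X')) (w : @hom A Z' (S X'))
    (a : @hom (stable hF) X X') (b : @hom (stable hF) Y Y')
    (c : @hom (stable hF) Z Z'),
  [/\ E X' Y' Z' i p, u \oc i = susp_i sD X', w \oc p = susp_p sD X' \oc u,
      [/\ is_iso a, is_iso b & is_iso c]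
    & triangle_morphism f g h
        (stable_mor hF i) (stable_mor hF p) (stable_mor hF w) a b c].

Section Fact.
Variables (n : nat) (n_gt1 : (1 < n)%N).

Definition ord_first : 'I_n := Ordinal (ltnW n_gt1).

Fact ord_last_subproof : (n.-1 < n)%N. Proof. by rewrite prednK // ltnW. Qed.
Definition ord_last : 'I_n := Ordinal ord_last_subproof.

Fact ord_first_le (j : 'I_n) : (ord_first <= j)%N. Proof. by []. Qed.
Fact le_ord_last (j : 'I_n) : (j <= ord_last)%N.
Proof. by rewrite /= -ltnS prednK // ltnW. Qed.

Section Path.
Variables (A : preadditive) (X : 'I_n -> A).
Variable d : forall i j : 'I_n, j = i.+1 :> nat -> hom (X i) (X j).

Definition path_id (i j : 'I_n) (e : i = j) : hom (X i) (X j) :=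
  match e in _ = k return hom (X i) (X k) with erefl => idm (X i) end.

Fact path_bound k (i j : 'I_n) : j = (k.+1 + i)%N :> nat -> (k + i < n)%N.
Proof. by move=> e; rewrite -addSn -e ltnW. Qed.

Fixpoint path_steps (k : nat) (i j : 'I_n) :
    j = (k + i)%N :> nat -> hom (X i) (X j) :=
  match k return j = (k + i)%N :> nat -> hom (X i) (X j) with
  | 0 => fun e => path_id (ord_inj (esym e))
  | k'.+1 => fun e =>
      let l := Ordinal (path_bound e) in
      @d l j e \oc @path_steps k' i l erefl
  end.

Definition path_comp (i j : 'I_n) (le_ij : (i <= j)%N) : hom (X i) (X j) :=
  path_steps (esym (subnK le_ij)).
End Path.

Variables (A : preadditive) (T : functor A A) (w : nat_trans (id_functor A) T).

(** [fact_d] is indexed by a pair [(j, j+1)] of indices, so that no transport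
    between equal indices is needed; [fact_dlast] is d^(n-1). *)
Record factorization := Factorization {
  fact_ob :> 'I_n -> A;
  fact_d : forall i j : 'I_n, j = i.+1 :> nat -> hom (fact_ob i) (fact_ob j);
  fact_dlast : hom (fact_ob ord_last) (T (fact_ob ord_first));
  fact_eq0 :
    fact_dlast \oc path_comp fact_d (le_ord_last ord_first) = w (fact_ob ord_first);
  fact_eq : forall j : 'I_n, (0 < j)%N ->
    fmap T (path_comp fact_d (ord_first_le j)) \oc fact_dlast
      \oc path_comp fact_d (le_ord_last j) = w (fact_ob j) }.

Arguments fact_d _ {_ _} _.

Record fact_hom (X Y : factorization) := FactHom {
  fact_mor :> forall j : 'I_n, hom (X j) (Y j);
  fact_morE : forall (i j : 'I_n) (e : j = i.+1 :> nat),
    fact_mor j \oc fact_d X e = fact_d Y e \oc fact_mor i;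
  fact_mor_lastE :
    fmap T (fact_mor ord_first) \oc fact_dlast X = fact_dlast Y \oc fact_mor ord_last }.

Lemma fact_hom_eq (X Y : factorization) (f g : fact_hom X Y) :
  (forall j, f j = g j) -> f = g.
Proof.
case: f g => [f fe fl] [g ge gl] /= efg.
have {}efg : f = g by apply: functional_extensionality_dep.
by case: g / efg ge gl => ge gl; congr FactHom; apply: Prop_irrelevance.
Qed.

HB.instance Definition _ (X Y : factorization) := gen_eqMixin (fact_hom X Y).
HB.instance Definition _ (X Y : factorization) := gen_choiceMixin (fact_hom X Y).

Hypothesis T_add : is_additive_functor T.

Fact fmap_add0 (X Y : A) : fmap T (0 : hom X Y) = 0.
Proof. by apply: (addrI (fmap T 0)); rewrite -T_add !addr0. Qed.

Fact fmap_addN (X Y : A) (f : hom X Y) : fmap T (- f) = - fmap T f.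
Proof. by apply: (addrI (fmap T f)); rewrite -T_add !subrr fmap_add0. Qed.

Program Definition fact_zero (X Y : factorization) : fact_hom X Y :=
  @FactHom X Y (fun j => 0) _ _.
Next Obligation. by move=> *; rewrite comp0m compm0. Qed.
Next Obligation. by move=> *; rewrite fmap_add0 comp0m compm0. Qed.

Program Definition fact_opp (X Y : factorization) (f : fact_hom X Y) : fact_hom X Y :=
  @FactHom X Y (fun j => - f j) _ _.
Next Obligation. by move=> *; rewrite compNm compmN fact_morE. Qed.
Next Obligation. by move=> *; rewrite fmap_addN compNm compmN fact_mor_lastE. Qed.

Program Definition fact_add (X Y : factorization) (f g : fact_hom X Y) : fact_hom X Y :=
  @FactHom X Y (fun j => f j + g j) _ _.
Next Obligation. by move=> *; rewrite compmDl compmDr !fact_morE. Qed.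
Next Obligation. by move=> *; rewrite T_add compmDl compmDr !fact_mor_lastE. Qed.

Program Definition fact_id (X : factorization) : fact_hom X X :=
  @FactHom X X (fun j => idm (X j)) _ _.
Next Obligation. by move=> *; rewrite comp1m compm1. Qed.
Next Obligation. by move=> *; rewrite fmap1 comp1m compm1. Qed.

Program Definition fact_comp (X Y Z : factorization)
    (g : fact_hom Y Z) (f : fact_hom X Y) : fact_hom X Z :=
  @FactHom X Z (fun j => g j \oc f j) _ _.
Next Obligation. by move=> *; rewrite -compmA fact_morE !compmA fact_morE. Qed.
Next Obligation.
by move=> *; rewrite fmapM -compmA fact_mor_lastE !compmA fact_mor_lastE.
Qed.

Section FactZmod.
Variables X Y : factorization.

Fact fact_addA : associative (@fact_add X Y).
Proof. by move=> f g h; apply: fact_hom_eq => j; apply: addrA. Qed.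
Fact fact_addC : commutative (@fact_add X Y).
Proof. by move=> f g; apply: fact_hom_eq => j; apply: addrC. Qed.
Fact fact_add0 : left_id (fact_zero X Y) (@fact_add X Y).
Proof. by move=> f; apply: fact_hom_eq => j; apply: add0r. Qed.
Fact fact_addN : left_inverse (fact_zero X Y) (@fact_opp X Y) (@fact_add X Y).
Proof. by move=> f; apply: fact_hom_eq => j; apply: addNr. Qed.

(** The addition uses [T_add], hence a local structure rather than an instance. *)
Definition fact_hom_zmod : zmodType :=
  HB.pack (fact_hom X Y)
    (GRing.isZmodule.Build (fact_hom X Y) fact_addA fact_addC fact_add0 fact_addN).
End FactZmod.

Fact fact_compA (W X Y Z : factorization) (h : fact_hom_zmod Y Z)
    (g : fact_hom_zmod X Y) (f : fact_hom_zmod W X) :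
  fact_comp h (fact_comp g f) = fact_comp (fact_comp h g) f.
Proof. by apply: fact_hom_eq => j; apply: compmA. Qed.

Fact fact_comp1m (X Y : factorization) (f : fact_hom_zmod X Y) :
  fact_comp (fact_id Y) f = f.
Proof. by apply: fact_hom_eq => j; apply: comp1m. Qed.

Fact fact_compm1 (X Y : factorization) (f : fact_hom_zmod X Y) :
  fact_comp f (fact_id X) = f.
Proof. by apply: fact_hom_eq => j; apply: compm1. Qed.

Fact fact_compDl (X Y Z : factorization) (g h : fact_hom_zmod Y Z)
    (f : fact_hom_zmod X Y) :
  fact_comp (g + h) f = fact_add (fact_comp g f) (fact_comp h f).
Proof. by apply: fact_hom_eq => j; apply: compmDl. Qed.

Fact fact_compDr (X Y Z : factorization) (h : fact_hom_zmod Y Z)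
    (f g : fact_hom_zmod X Y) :
  fact_comp h (f + g) = fact_add (fact_comp h f) (fact_comp h g).
Proof. by apply: fact_hom_eq => j; apply: compmDr. Qed.

Definition Fact_cat : preadditive :=
  @Preadditive factorization fact_hom_zmod fact_id fact_comp
    fact_compA fact_comp1m fact_compm1 fact_compDl fact_compDr.

Definition fact_exact (E : pair_class A) : pair_class Fact_cat :=
  fun (X Y Z : factorization) (l : fact_hom X Y) (p : fact_hom Y Z) =>
    forall j : 'I_n, E (X j) (Y j) (Z j) (l j) (p j).

End Fact.

(** Not automatic for an additive autoequivalence [T]: the swap on [B * B] does
    not respect [E1 * E2] when [E1] and [E2] are different exact structures on
    [B], and the category of factorizations may then fail to be Frobenius. *)
Definition preserves_reflects_conflations (A : preadditive) (E : pair_class A)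
    (T : functor A A) : Prop :=
  forall (X Y Z : A) (i : hom X Y) (p : hom Y Z),
    E X Y Z i p <-> E (T X) (T Y) (T Z) (fmap T i) (fmap T p).

(* Main.v *)
Require Import Defs.
From mathcomp Require Import all_boot all_algebra.
From mathcomp Require Import boolp.
(* [hom] denotes below the morphisms of a preadditive category. *)
Import Defs.

Set Implicit Arguments.
Unset Strict Implicit.
Unset Printing Implicit Defensive.

Import GRing.Theory.
Local Open Scope ring_scope.

(** The exact structure is checked componentwise. The components of a pushout
    or of a cokernel inherit structure maps from their universal properties, and
    the relation between a factorization and [w] says that [loop], the composite
    once around the sequence, is [w]; both sides are natural, so that the
    relation passes to any sequence that is a target of jointly epic families of
    maps from factorizations ([loop_natural], [loop_out]). Kernels and pullbacks
    are dual, given that an equivalence preserves them ([fmap_kernel],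
    [fmap_pullback]). Hence a morphism with inflations as components is an
    inflation ([fact_inflation]), and Quillen's axioms follow from those of the
    base category ([fact_is_exact]).

    For the Frobenius property, evaluation at an index has a right adjoint
    [coind], whose values are also values of left adjoints of evaluations. So
    [coind k I] is projective and injective when [I] is, as soon as [T] respects
    conflations. A finite sum of such objects covers every component of a given
    factorization ([fact_cover]), or receives inflations from all of them
    ([fact_hull]).

    The stable category of any Frobenius category is triangulated, which is
    Happel's theorem ([stable_triangulated]). The suspension is an equivalence
    since maps extend along inflations into injective objects and lift along
    deflations from projective objects, and the two constructions are mutually
    inverse up to maps factoring through projectives. After adding an injective
    object to its target, a morphism becomes an inflation ([stable_inflation]);
    this gives cones, and reduces the octahedral axiom to Noether's isomorphism
    theorem ([conflation_noether]). A commutative square between inflations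
    induces a morphism of triangles ([conflation_triangle_morphism]). Rotation
    comes from the conflation [Y -> I X + Z -> S X] attached to
    [X -> Y -> Z] ([pullback_of_same_kernel]). The converse rotation and the
    independence of the octahedral axiom of the chosen triangles are formal: they
    rest on the five lemma for triangles ([triangle_five]). *)

(** * Preadditive and exact categories *)

Definition compm_unit :=
  (comp1m, compm1, comp0m, compm0, addr0, add0r, compNm, compmN, oppr0, subr0).

Section Preadditive.
Variable A : preadditive.

Lemma compmBl (X Y Z : A) (g h : hom Y Z) (f : hom X Y) :
  (g - h) \oc f = g \oc f - h \oc f.
Proof. by rewrite compmDl compNm. Qed.

Lemma compmBr (X Y Z : A) (h : hom Y Z) (f g : hom X Y) :
  h \oc (f - g) = h \oc f - h \oc g.
Proof. by rewrite compmDr compmN. Qed.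

Lemma is_iso_id (X : A) : is_iso (idm X).
Proof. by exists (idm X); rewrite comp1m. Qed.

Lemma is_iso_comp (X Y Z : A) (g : hom Y Z) (f : hom X Y) :
  is_iso g -> is_iso f -> is_iso (g \oc f).
Proof.
move=> [g' [g1 g2]] [f' [f1 f2]]; exists (f' \oc g'); split.
  by rewrite -compmA (compmA g') g1 comp1m.
by rewrite -compmA (compmA f) f2 comp1m.
Qed.

(** The hypotheses provide a left and a right inverse of [f]. *)
Lemma is_iso_sandwich (X Y : A) (f : hom X Y) (g h : hom Y X) :
  is_iso (g \oc f) -> is_iso (f \oc h) -> is_iso f.
Proof.
move=> [a [a1 _]] [b [_ b2]].
have l : (a \oc g) \oc f = idm X by rewrite -compmA.
have r : f \oc (h \oc b) = idm Y by rewrite compmA.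
have lr : a \oc g = h \oc b by rewrite -[a \oc g]compm1 -r compmA l comp1m.
by exists (h \oc b); rewrite -{1}lr.
Qed.

Lemma is_biproduct_sym (X Y S : A) (i1 : hom X S) (i2 : hom Y S)
    (p1 : hom S X) (p2 : hom S Y) :
  is_biproduct i1 i2 p1 p2 -> is_biproduct i2 i1 p2 p1.
Proof. by case=> *; split=> //; rewrite addrC. Qed.

(** The second half is the form that applies inside a right-associated
    composite, where all normal forms below live. *)
Lemma biproductE (X Y S : A) (i1 : hom X S) (i2 : hom Y S)
    (p1 : hom S X) (p2 : hom S Y) : is_biproduct i1 i2 p1 p2 ->
  ((p1 \oc i1 = idm X) * (p2 \oc i2 = idm Y) * (p1 \oc i2 = 0) * (p2 \oc i1 = 0))
  * ((forall W (x : hom W X), p1 \oc (i1 \oc x) = x)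
   * (forall W (x : hom W Y), p2 \oc (i2 \oc x) = x)
   * (forall W (x : hom W Y), p1 \oc (i2 \oc x) = 0)
   * (forall W (x : hom W X), p2 \oc (i1 \oc x) = 0)).
Proof.
case=> b11 b22 b12 b21 _; split; first by [].
split; [split; [split|]|] => W x; by rewrite compmA ?(b11, b22, b12, b21) ?comp1m ?comp0m.
Qed.

Lemma biproduct_sum (X Y S : A) (i1 : hom X S) (i2 : hom Y S)
    (p1 : hom S X) (p2 : hom S Y) : is_biproduct i1 i2 p1 p2 ->
  (forall W (x : hom W S), i1 \oc (p1 \oc x) + i2 \oc (p2 \oc x) = x)
  * (forall W (x : hom S W), x \oc (i1 \oc p1) + x \oc (i2 \oc p2) = x).
Proof.
case=> _ _ _ _ b; split=> W x; first by rewrite !compmA -compmDl b comp1m.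
by rewrite -compmDr b compm1.
Qed.

Lemma kernel_mono (X Y Z W : A) (k : hom X Y) (g : hom Y Z) (s t : hom W X) :
  is_kernel k g -> k \oc s = k \oc t -> s = t.
Proof.
move=> [gk hk] e; have [|r [_ u]] := hk W (k \oc t).
  by rewrite compmA gk comp0m.
by rewrite -(u s e) -(u t).
Qed.

Lemma cokernel_epi (X Y Z W : A) (f : hom X Y) (c : hom Y Z) (s t : hom Z W) :
  is_cokernel f c -> s \oc c = t \oc c -> s = t.
Proof.
move=> [cf hc] e; have [|r [_ u]] := hc W (t \oc c).
  by rewrite -compmA cf compm0.
by rewrite -(u s e) -(u t).
Qed.

Lemma kernel_unique (X X' Y Z : A) (k : hom X Y) (k' : hom X' Y) (g : hom Y Z) :
  is_kernel k g -> is_kernel k' g -> exists a : hom X X', is_iso a /\ k' \oc a = k.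
Proof.
move=> kk kk'; have [gk hk] := kk; have [gk' hk'] := kk'.
have [a [ea _]] := hk' _ k gk; have [b [eb _]] := hk _ k' gk'.
exists a; split=> //; exists b; split.
  by apply: (kernel_mono kk); rewrite compmA eb ea compm1.
by apply: (kernel_mono kk'); rewrite compmA ea eb compm1.
Qed.

Lemma cokernel_unique (X Y Z Z' : A) (f : hom X Y) (c : hom Y Z) (c' : hom Y Z') :
  is_cokernel f c -> is_cokernel f c' ->
  exists a : hom Z Z', is_iso a /\ a \oc c = c'.
Proof.
move=> kk kk'; have [gk hk] := kk; have [gk' hk'] := kk'.
have [a [ea _]] := hk _ c' gk'; have [b [eb _]] := hk' _ c gk.
exists a; split=> //; exists b; split.
  by apply: (cokernel_epi kk); rewrite -compmA ea eb comp1m.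
by apply: (cokernel_epi kk'); rewrite -compmA eb ea comp1m.
Qed.

Lemma pullback_mono (Y Z Y' Z' W : A) (p : hom Y Z) (f : hom Z' Z)
    (f' : hom Y' Y) (p' : hom Y' Z') (s t : hom W Y') :
  is_pullback p f f' p' -> f' \oc s = f' \oc t -> p' \oc s = p' \oc t -> s = t.
Proof.
move=> [e h] e1 e2; have [|r [_ u]] := h W (f' \oc t) (p' \oc t).
  by rewrite !compmA e.
by rewrite -(u s) // -(u t).
Qed.

Lemma pushout_epi (X Y X' Y' W : A) (i : hom X Y) (f : hom X X')
    (f' : hom Y Y') (i' : hom X' Y') (s t : hom Y' W) :
  is_pushout i f f' i' -> s \oc f' = t \oc f' -> s \oc i' = t \oc i' -> s = t.
Proof.
move=> [e h] e1 e2; have [|r [_ u]] := h W (t \oc f') (t \oc i').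
  by rewrite -!compmA e.
by rewrite -(u s) // -(u t).
Qed.

Lemma cokernel_id (X O : A) : is_zero_object O -> is_cokernel (idm X) (0 : hom X O).
Proof.
move=> [_ O0]; split=> [|W t]; first by rewrite comp0m.
by rewrite compm1 => ->; exists 0; split=> [|s _]; [rewrite comp0m|apply: O0].
Qed.

Lemma kernel_id (X O : A) : is_zero_object O -> is_kernel (0 : hom O X) (idm X).
Proof.
move=> [O0 _]; split=> [|W t]; first by rewrite compm0.
by rewrite comp1m => ->; exists 0; split=> [|s _]; [rewrite comp0m|apply: O0].
Qed.

End Preadditive.

Section Exact.
Variables (A : preadditive) (E : pair_class A) (hX : is_exact E).

Lemma inflation_coker_conflation (X Y Z : A) (i : hom X Y) (c : hom Y Z) :
  inflation E i -> is_cokernel i c -> E i c.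
Proof.
move=> [Z' [p hp]] hc.
have [a [ia ea]] := cokernel_unique (exact_coker hX hp) hc.
apply: (exact_iso hX (is_iso_id X) (is_iso_id Y) ia) hp.
  by rewrite comp1m compm1.
by rewrite ea compm1.
Qed.

Lemma deflation_ker_conflation (X Y Z : A) (k : hom X Y) (p : hom Y Z) :
  deflation E p -> is_kernel k p -> E k p.
Proof.
move=> [X' [i hi]] hk.
have [a [ia ea]] := kernel_unique (exact_ker hX hi) hk.
apply: (exact_iso hX ia (is_iso_id Y) (is_iso_id Z)) hi.
  by rewrite comp1m ea.
by rewrite comp1m compm1.
Qed.

Lemma conflation_id (X O : A) : is_zero_object O -> E (idm X) (0 : hom X O).
Proof.
by move=> hO; apply: inflation_coker_conflation (cokernel_id _ hO); apply: exact_infl1.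
Qed.

Lemma conflation_0 (X O : A) : is_zero_object O -> E (0 : hom O X) (idm X).
Proof.
by move=> hO; apply: deflation_ker_conflation (kernel_id _ hO); apply: exact_defl1.
Qed.

Lemma deflation_iso_r (X X' Y : A) (p : hom X Y) (a : hom X' X) :
  is_iso a -> deflation E p -> deflation E (p \oc a).
Proof.
move=> [b [ba ab]] [K [i hi]]; exists K, (b \oc i).
have ib : is_iso b by exists a.
apply: (exact_iso hX (is_iso_id K) ib (is_iso_id Y)) hi; first by rewrite compm1.
by rewrite comp1m -compmA ab compm1.
Qed.

Lemma inflation_iso_l (X Y Y' : A) (i : hom X Y) (a : hom Y Y') :
  is_iso a -> inflation E i -> inflation E (a \oc i).
Proof.
move=> ia [Z [p hp]]; have [b [ba ab]] := ia; exists Z, (p \oc b).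
apply: (exact_iso hX (is_iso_id X) ia (is_iso_id Z)) hp; first by rewrite compm1.
by rewrite comp1m -compmA ba compm1.
Qed.

Lemma deflation_of_pullback (Y Z Y' Z' : A) (p : hom Y Z) (f : hom Z' Z)
    (f' : hom Y' Y) (p' : hom Y' Z') :
  is_pullback p f f' p' -> deflation E p -> deflation E p'.
Proof.
move=> pb hp; have [Y2 [f2 [p2 [pb2 h2]]]] := exact_pullback hX f hp.
have [e u] := pb; have [e2 u2] := pb2.
have [a [[a1 a2] _]] := u2 _ _ _ e; have [b [[b1 b2] _]] := u _ _ _ e2.
rewrite -a2; apply: deflation_iso_r h2; exists b; split.
  by apply: (pullback_mono pb); rewrite compmA ?b1 ?b2 ?a1 ?a2 compm1.
by apply: (pullback_mono pb2); rewrite compmA ?a1 ?a2 ?b1 ?b2 compm1.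
Qed.

Lemma inflation_of_pushout (X Y X' Y' : A) (i : hom X Y) (f : hom X X')
    (f' : hom Y Y') (i' : hom X' Y') :
  is_pushout i f f' i' -> inflation E i -> inflation E i'.
Proof.
move=> po hi; have [Y2 [f2 [i2 [po2 h2]]]] := exact_pushout hX f hi.
have [e u] := po; have [e2 u2] := po2.
have [a [[a1 a2] _]] := u2 _ _ _ e; have [b [[b1 b2] _]] := u _ _ _ e2.
rewrite -a2; apply: inflation_iso_l h2; exists b; split.
  by apply: (pushout_epi po2); rewrite -compmA ?a1 ?a2 ?b1 ?b2 comp1m.
by apply: (pushout_epi po); rewrite -compmA ?b1 ?b2 ?a1 ?a2 comp1m.
Qed.

(** The morphism [[p, f]] is the composite of [p + id], a pullback of [p], and
    of [[id, f]], a pullback of the deflation from [Y] to the zero object. *)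
Lemma deflation_copair (X Y Z S : A) (i1 : hom X S) (i2 : hom Y S)
    (p1 : hom S X) (p2 : hom S Y) (p : hom X Z) (f : hom Y Z) :
  is_biproduct i1 i2 p1 p2 -> deflation E p -> deflation E (p \oc p1 + f \oc p2).
Proof.
move=> hb hp.
have [[O hO] hS] := exact_additive hX.
have [S' [j1 [j2 [q1 [q2 hc]]]]] := hS Z Y.
have -> : p \oc p1 + f \oc p2
    = (q1 + f \oc q2) \oc (j1 \oc p \oc p1 + j2 \oc p2).
  by rewrite !compmDl !compmDr -!compmA !(biproductE hc) !compm_unit.
apply: (exact_deflM hX).
- apply: (deflation_of_pullback (p := p) (f := q1) (f' := p1)) => //; split.
    by rewrite !compmDr -!compmA !(biproductE hc) !compm_unit.
  move=> W u v e; exists (i1 \oc u + i2 \oc (q2 \oc v)); split; last first.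
    move=> s [<- <-].
    rewrite !compmDl !compmDr -!compmA !(biproductE hc) !compm_unit.
    by rewrite (biproduct_sum hb).
  split; first by rewrite compmDr !(biproductE hb) !compm_unit.
  rewrite compmDl !compmDr -!compmA !(biproductE hb) !compm_unit e.
  by rewrite (biproduct_sum hc).
- have hY : deflation E (0 : hom Y O) by exists Y, (idm Y); apply: conflation_id.
  apply: (deflation_of_pullback (p := (0 : hom Y O)) (f := (0 : hom Z O)) (f' := q2)) => //.
  split=> [|W u v _]; first by rewrite !comp0m.
  exists (j1 \oc (v - f \oc u) + j2 \oc u); split.
    rewrite !compmDl !compmDr -!compmA !(biproductE hc) !compm_unit.
    by rewrite subrK.
  move=> s [<- <-]; rewrite compmDl -compmA addrK.
  by rewrite (biproduct_sum hc).
Qed.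

Lemma inflation_pair (X Y Z S : A) (i1 : hom X S) (i2 : hom Y S)
    (p1 : hom S X) (p2 : hom S Y) (i : hom Z X) (f : hom Z Y) :
  is_biproduct i1 i2 p1 p2 -> inflation E i -> inflation E (i1 \oc i + i2 \oc f).
Proof.
move=> hb hi.
have [[O hO] hS] := exact_additive hX.
have [S' [j1 [j2 [q1 [q2 hc]]]]] := hS Z Y.
have -> : i1 \oc i + i2 \oc f
    = (i1 \oc i \oc q1 + i2 \oc q2) \oc (j1 + j2 \oc f).
  by rewrite !compmDl !compmDr -!compmA !(biproductE hc) !compm_unit.
apply: (exact_inflM hX); last first.
- apply: (inflation_of_pushout (i := i) (f := j1) (f' := i1)) => //; split.
    by rewrite !compmDl -!compmA !(biproductE hc) !compm_unit.
  move=> W u v e; exists (u \oc p1 + v \oc (j2 \oc p2)); split; last first.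
    move=> s [<- <-].
    rewrite -!compmA compmDl -!compmA !(biproductE hc) !compm_unit.
    by rewrite (biproduct_sum hb).
  split; first by rewrite compmDl -!compmA !(biproductE hb) !compm_unit.
  rewrite compmDl !compmDr -!compmA !(biproductE hb) !compm_unit (compmA u) e -compmA.
  by rewrite (biproduct_sum hc).
- have hY : inflation E (0 : hom O Y) by exists Y, (idm Y); apply: conflation_0.
  apply: (inflation_of_pushout (i := (0 : hom O Y)) (f := (0 : hom O Z)) (f' := j2)) => //.
  split=> [|W u v _]; first by rewrite !compm0.
  exists ((v - u \oc f) \oc q1 + u \oc q2); split.
    rewrite !compmDl !compmDr !compNm -!compmA !(biproductE hc) !compm_unit.
    by rewrite subrK.
  move=> s [<- <-]; rewrite compmDr compmA addrK -!compmA.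
  by rewrite (biproduct_sum hc).
Qed.

(** A cone over the square lifts to [Y] after a base change along a deflation,
    and can then be corrected by a map into the common kernel [X]. The lift
    descends since a map into [Y] killed by [p] and [u] is zero. *)
Lemma pullback_of_same_kernel (X Y Z I S : A) (i : hom X Y) (p : hom Y Z)
    (k : hom X I) (q : hom I S) (u : hom Y I) (w : hom Z S) :
  E i p -> E k q -> u \oc i = k -> w \oc p = q \oc u -> is_pullback q w u p.
Proof.
move=> hip hkq ui wp; split=> [|W t z e]; first by rewrite wp.
have ker := exact_ker hX hip; have ker' := exact_ker hX hkq.
have mono V (y : hom V Y) : p \oc y = 0 -> u \oc y = 0 -> y = 0.
  move=> py uy; have [x [ex _]] := ker.2 _ _ py.
  rewrite -ex (_ : x = 0) ?compm0 //.
  by apply: (kernel_mono ker'); rewrite compm0 -uy -ex compmA ui.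
have hp : deflation E p by exists X, i.
have [W' [y' [r [[pb _] [M [m hmr]]]]]] := exact_pullback hX z hp.
have [|x [ex _]] := ker'.2 _ (t \oc r - u \oc y').
  by rewrite compmBr !compmA e -wp -!compmA pb subrr.
pose y2 := y' + i \oc x.
have py2 : p \oc y2 = z \oc r by rewrite compmDr compmA ker.1 comp0m addr0.
have uy2 : u \oc y2 = t \oc r by rewrite compmDr compmA ui ex addrC subrK.
have [rm hr] := exact_coker hX hmr.
have [|y [ey _]] := hr _ y2.
  by apply: mono; rewrite compmA ?py2 ?uy2 -compmA rm compm0.
exists y; split; last first.
  move=> s [us ps]; apply/eqP; rewrite -subr_eq0; apply/eqP; apply: mono.
    rewrite compmBr ps; apply/eqP; rewrite subr_eq0; apply/eqP.
    by apply: (cokernel_epi (exact_coker hX hmr)); rewrite -compmA ey py2.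
  rewrite compmBr us; apply/eqP; rewrite subr_eq0; apply/eqP.
  by apply: (cokernel_epi (exact_coker hX hmr)); rewrite -compmA ey uy2.
by split; apply: (cokernel_epi (exact_coker hX hmr)); rewrite -compmA ey.
Qed.

(** Noether's isomorphism theorem: [Z / X] is the pushout of [g] along the
    projection from [Y] to [Y / X]. *)
Lemma conflation_noether (X Y Z YX ZX ZY : A) (f : hom X Y) (g : hom Y Z)
    (a : hom Y YX) (b : hom Z ZX) (c : hom Z ZY) (u : hom YX ZX) (v : hom ZX ZY) :
  E f a -> E g c -> E (g \oc f) b ->
  u \oc a = b \oc g -> v \oc b = c -> E u v.
Proof.
move=> hf hg hgf eu ev.
have kf := exact_coker hX hf; have kg := exact_coker hX hg.
have kgf := exact_coker hX hgf.
have po : is_pushout g a b u.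
  split=> [//|W s t e].
  have [|r [er _]] := kgf.2 _ s; first by rewrite compmA e -compmA kf.1 compm0.
  exists r; split; last by move=> r' [er' _]; apply: (cokernel_epi kgf); rewrite er er'.
  by split=> //; apply: (cokernel_epi kf); rewrite -compmA eu compmA er.
apply: inflation_coker_conflation.
  by apply: inflation_of_pushout po _; exists ZY, c.
split=> [|W t tu].
  by apply: (cokernel_epi kf); rewrite -compmA eu compmA ev kg.1 comp0m.
have [|r [er _]] := kg.2 _ (t \oc b).
  by rewrite -compmA -eu compmA tu comp0m.
exists r; split=> [|r' er'].
  by apply: (cokernel_epi kgf); rewrite -compmA ev.
by apply: (cokernel_epi kg); rewrite er -er' -compmA ev.
Qed.

End Exact.

(** * Fully faithful functors *)

Lemma iso_cancel_l (A : preadditive) (X Y Z : A) (a : hom Y Z) (s t : hom X Y) :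
  is_iso a -> a \oc s = a \oc t -> s = t.
Proof. by move=> [b [e _]] h; rewrite -[s]comp1m -[t]comp1m -e -!compmA h. Qed.

Lemma iso_cancel_r (A : preadditive) (X Y Z : A) (a : hom X Y) (s t : hom Y Z) :
  is_iso a -> s \oc a = t \oc a -> s = t.
Proof. by move=> [b [_ e]] h; rewrite -[s]compm1 -[t]compm1 -e !compmA h. Qed.

Section FullyFaithful.
Variables (A B : preadditive) (F : functor A B).

Definition faithful := forall (X Y : A) (f g : hom X Y), fmap F f = fmap F g -> f = g.

Definition full := forall (X Y : A) (g : hom (F X) (F Y)), exists f, fmap F f = g.

Definition ess_surjective := forall Y : B, exists (X : A) (e : hom (F X) Y), is_iso e.

Lemma fmap_iso (X Y : A) (f : hom X Y) : is_iso f -> is_iso (fmap F f).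
Proof. by move=> [g [e1 e2]]; exists (fmap F g); rewrite -!fmapM e1 e2 !fmap1. Qed.

Hypotheses (F_faithful : faithful) (F_full : full).

Lemma fmap_iso_reflect (X Y : A) (f : hom X Y) : is_iso (fmap F f) -> is_iso f.
Proof.
move=> [g' [e1 e2]]; have [g eg] := F_full g'; exists g.
by split; apply: F_faithful; rewrite fmapM fmap1 eg.
Qed.

Lemma equivalence_of_fully_faithful : ess_surjective -> is_equivalence F.
Proof.
move=> F_es.
pose G0 Y := sval (cid (F_es Y)).
pose e Y : hom (F (G0 Y)) Y := sval (cid (svalP (cid (F_es Y)))).
have e_iso Y : is_iso (e Y) := svalP (cid (svalP (cid (F_es Y)))).
pose e' Y := sval (cid (e_iso Y)).
have e'e Y : e' Y \oc e Y = idm _ := (svalP (cid (e_iso Y))).1.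
have ee' Y : e Y \oc e' Y = idm _ := (svalP (cid (e_iso Y))).2.
pose G1 Y Z (f : hom Y Z) : hom (G0 Y) (G0 Z) := sval (cid (F_full (e' Z \oc f \oc e Y))).
have G1E Y Z (f : hom Y Z) : fmap F (G1 Y Z f) = e' Z \oc f \oc e Y.
  exact: svalP (cid (F_full (e' Z \oc f \oc e Y))).
have G_1 Y : G1 Y Y (idm Y) = idm (G0 Y).
  by apply: F_faithful; rewrite G1E fmap1 compm1 e'e.
have G_M X Y Z (g : hom Y Z) (f : hom X Y) : G1 X Z (g \oc f) = G1 Y Z g \oc G1 X Y f.
  by apply: F_faithful; rewrite fmapM !G1E -!compmA (compmA (e Y)) ee' comp1m.
pose G := Functor G_1 G_M; exists G; split.
- pose m X : hom (G0 (F X)) X := sval (cid (F_full (e (F X)))).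
  have mE X : fmap F (m X) = e (F X) := svalP (cid (F_full (e (F X)))).
  have nat X Y (f : hom X Y) :
      m Y \oc fmap (comp_functor G F) f = fmap (id_functor A) f \oc m X.
    by apply: F_faithful; rewrite !fmapM !mE G1E !compmA ee' comp1m.
  exists (@NatTrans A A (comp_functor G F) (id_functor A) m nat) => X /=.
  by apply: fmap_iso_reflect; rewrite mE.
- have nat X Y (f : hom X Y) :
      e Y \oc fmap (comp_functor F G) f = fmap (id_functor B) f \oc e X.
    by rewrite /= G1E !compmA ee' comp1m.
  by exists (@NatTrans B B (comp_functor F G) (id_functor B) e nat).
Qed.

End FullyFaithful.

Section Equivalence.
Variables (A B : preadditive) (F : functor A B) (hF : is_equivalence F).

Lemma equivalence_faithful : faithful F.
Proof.
have [G [[a a_iso] _]] := hF; move=> X Y f g e.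
apply: (iso_cancel_r (a_iso X)).
have := nt_natural a f; have := nt_natural a g; rewrite /= => <- <-.
by rewrite e.
Qed.

Lemma equivalence_full : full F.
Proof.
have [G [[a a_iso] [b b_iso]]] := hF; move=> X Y g.
have G_faithful (U V : B) (s t : hom U V) : fmap G s = fmap G t -> s = t.
  move=> e; apply: (iso_cancel_r (b_iso U)).
  have := nt_natural b s; have := nt_natural b t; rewrite /= => <- <-.
  by rewrite e.
have [c [ca ac]] := a_iso X.
exists (a Y \oc fmap G g \oc c); apply: G_faithful.
apply: (iso_cancel_l (a_iso Y)).
have := nt_natural a (a Y \oc fmap G g \oc c); rewrite /= => ->.
by rewrite -compmA ca compm1.
Qed.

Lemma equivalence_ess_surjective : ess_surjective F.
Proof. by have [G [_ [b b_iso]]] := hF; move=> Y; exists (G Y), (b Y); apply: b_iso. Qed.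

End Equivalence.

(** * Formal consequences of the axioms of triangulated categories *)

Section Triangulation.
Variables (C : preadditive) (S : functor C C) (D : triangle_class S).

Definition octahedron (X Y Z Z' X' Y' : C) (f : hom X Y) (g : hom Y Z)
    (i : hom Y Z') (i' : hom Z' (S X)) (j : hom Z X') (j' : hom X' (S Y))
    (k : hom Z Y') (k' : hom Y' (S X)) : Prop :=
  exists (u : hom Z' Y') (v : hom Y' X'),
    [/\ D u v (fmap S i \oc j'),
        u \oc i = k \oc g, k' \oc u = i', v \oc k = j
      & j' \oc v = fmap S f \oc k'].

(** The part of the axioms that is checked on a concrete class of triangles:
    rotation in one direction only, and the octahedral axiom for one choice
    of the two composable morphisms in each isomorphism class. *)
Record triangulation_basis : Prop := TriangulationBasis {
  tb_faithful : faithful S;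
  tb_full : full S;
  tb_iso : forall (X Y Z X' Y' Z' : C)
      (f : hom X Y) (g : hom Y Z) (h : hom Z (S X))
      (f' : hom X' Y') (g' : hom Y' Z') (h' : hom Z' (S X'))
      (a : hom X X') (b : hom Y Y') (c : hom Z Z'),
    is_iso a -> is_iso b -> is_iso c -> triangle_morphism f g h f' g' h' a b c ->
    D f' g' h' -> D f g h;
  tb_zero : exists Z : C, is_zero_object Z;
  tb_id : forall X Z : C, is_zero_object Z -> D (idm X) (0 : hom X Z) 0;
  tb_cone : forall (X Y : C) (f : hom X Y), exists Z (g : hom Y Z) h, D f g h;
  tb_rotate : forall (X Y Z : C) (f : hom X Y) (g : hom Y Z) (h : hom Z (S X)),
    D f g h -> D g h (- fmap S f);
  tb_fill : forall (X Y Z X' Y' Z' : C)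
      (f : hom X Y) (g : hom Y Z) (h : hom Z (S X))
      (f' : hom X' Y') (g' : hom Y' Z') (h' : hom Z' (S X'))
      (a : hom X X') (b : hom Y Y'),
    D f g h -> D f' g' h' -> b \oc f = f' \oc a ->
    exists c : hom Z Z', triangle_morphism f g h f' g' h' a b c;
  tb_octahedron : forall (X Y Z : C) (f : hom X Y) (g : hom Y Z),
    exists (X0 Y0 Z0 : C) (f0 : hom X0 Y0) (g0 : hom Y0 Z0)
      (a : hom X X0) (b : hom Y Y0) (c : hom Z Z0),
    [/\ is_iso a, is_iso b & is_iso c] /\ b \oc f = f0 \oc a /\ c \oc g = g0 \oc b /\
    exists Z' X' Y' (i : hom Y0 Z') i' (j : hom Z0 X') j' (k : hom Z0 Y') k',
    [/\ D f0 i i', D g0 j j', D (g0 \oc f0) k k'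
      & octahedron f0 g0 i i' j j' k k'] }.

Hypothesis hD : triangulation_basis.

(** Compare the triangle with the rotated triangle of the identity of [W]. *)
Lemma triangle_weak_kernel (W X Y Z : C) (f : hom X Y) (g : hom Y Z)
    (h : hom Z (S X)) (t : hom W Y) :
  D f g h -> g \oc t = 0 -> exists s, t = f \oc s.
Proof.
move=> d gt; have [O hO] := tb_zero hD.
have [|c [_ _ e]] := tb_fill hD (a := t) (b := (0 : hom O Z))
  (tb_rotate hD (tb_id hD W hO)) (tb_rotate hD d); first by rewrite compm0 gt.
have [s es] := tb_full hD c; exists s; apply: (tb_faithful hD).
move: e; rewrite -es fmap1 compmN compm1 compNm -fmapM.
by move/oppr_inj.
Qed.

(** Such an endomorphism [e] is unipotent: [e - id] kills [g], and it factors
    through [g] as [h] kills it, so that its square is zero. *)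
Lemma triangle_endo_iso (X Y Z : C) (f : hom X Y) (g : hom Y Z)
    (h : hom Z (S X)) (e : hom Z Z) :
  D f g h -> e \oc g = g -> h \oc e = h -> is_iso e.
Proof.
move=> d eg he.
have [|r er] := triangle_weak_kernel (t := e - idm Z) (tb_rotate hD d).
  by rewrite compmBr he compm1 subrr.
have e2 : (e - idm Z) \oc (e - idm Z) = 0.
  by rewrite {2}er compmA compmBl eg comp1m subrr comp0m.
rewrite -[e](subrK (idm Z)); move: (e - idm Z) e2 => x x2.
exists (idm Z - x).
by rewrite !(compmBl, compmBr, compmDl, compmDr) x2 !compm_unit addrC addKr.
Qed.

Lemma triangle_five (X Y Z X' Y' Z' : C)
    (f : hom X Y) (g : hom Y Z) (h : hom Z (S X))
    (f' : hom X' Y') (g' : hom Y' Z') (h' : hom Z' (S X'))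
    (a : hom X X') (b : hom Y Y') (c : hom Z Z') :
  D f g h -> D f' g' h' -> triangle_morphism f g h f' g' h' a b c ->
  is_iso a -> is_iso b -> is_iso c.
Proof.
move=> d d' [e1 e2 e3] [a' [a'a aa']] [b' [b'b bb']].
have [|c' [_ e2' e3']] := tb_fill hD (a := a') (b := b') d' d.
  by rewrite -[f']compm1 -aa' (compmA f') -e1 -!compmA !compmA b'b comp1m.
apply: (is_iso_sandwich (g := c') (h := c')).
  apply: (triangle_endo_iso d); first by rewrite -compmA e2 compmA e2' -compmA b'b compm1.
  by rewrite compmA -e3' -compmA -e3 compmA -fmapM a'a fmap1 comp1m.
apply: (triangle_endo_iso d'); first by rewrite -compmA e2' compmA e2 -compmA bb' compm1.
by rewrite compmA -e3 -compmA -e3' compmA -fmapM aa' fmap1 comp1m.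
Qed.

(** Complete [f] to a triangle and compare the triple rotations of the two
    triangles, which have [- S f] as first morphism. *)
Lemma triangle_rotate_back (X Y Z : C) (f : hom X Y) (g : hom Y Z) (h : hom Z (S X)) :
  D g h (- fmap S f) -> D f g h.
Proof.
move=> d; have [Z' [g' [h' d']]] := tb_cone hD f.
have d3 := tb_rotate hD (tb_rotate hD d).
have d3' := tb_rotate hD (tb_rotate hD (tb_rotate hD d')).
have [|c m] := tb_fill hD (a := idm _) (b := idm _) d3 d3'; first by rewrite comp1m compm1.
have c_iso := triangle_five d3 d3' m (is_iso_id _) (is_iso_id _).
have [c' ec] := tb_full hD c; rewrite -{}ec in c_iso m.
have {}c_iso := fmap_iso_reflect (tb_faithful hD) (tb_full hD) c_iso.
have [_ e1 e2] := m; apply: (tb_iso hD) d'; [exact: is_iso_id|exact: is_iso_id|exact: c_iso|].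
split; first by rewrite comp1m compm1.
  apply: (tb_faithful hD); move: e1; rewrite compm1 compmN -fmapM => /oppr_inj ->.
  by rewrite compm1.
rewrite fmap1 comp1m; apply: (tb_faithful hD).
by move: e2; rewrite fmap1 comp1m compNm -fmapM => /oppr_inj.
Qed.

(** Triangles over isomorphic morphisms are isomorphic by [triangle_five], so
    that an octahedron can be transported from one choice to any other. *)
Lemma triangle_octahedron (X Y Z Z' X' Y' : C) (f : hom X Y) (g : hom Y Z)
    (i : hom Y Z') (i' : hom Z' (S X)) (j : hom Z X') (j' : hom X' (S Y))
    (k : hom Z Y') (k' : hom Y' (S X)) :
  D f i i' -> D g j j' -> D (g \oc f) k k' -> octahedron f g i i' j j' k k'.
Proof.
move=> df dg dgf.
have [X0 [Y0 [Z0 [f0 [g0 [a [b [c [[ia ib ic] [ef [eg H]]]]]]]]]]] :=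
  tb_octahedron hD f g.
have {H} [Z0' [X0' [Y0' [i0 [i0' [j0 [j0' [k0 [k0' [df0 dg0 dgf0 O]]]]]]]]]] := H.
have {O} [u0 [v0 [d0 ui ku vk jv]]] := O.
have [x [_ x2 x3]] := tb_fill hD df df0 ef.
have [y [_ y2 y3]] := tb_fill hD dg dg0 eg.
have egf : c \oc (g \oc f) = g0 \oc f0 \oc a by rewrite compmA eg -!compmA ef.
have [z [_ z2 z3]] := tb_fill hD dgf dgf0 egf.
have ix : is_iso x by apply: triangle_five df df0 _ ia ib; split.
have iy : is_iso y by apply: triangle_five dg dg0 _ ib ic; split.
have iz : is_iso z by apply: triangle_five dgf dgf0 _ ia ic; split.
have [y' [y'y yy']] := iy; have [z' [z'z zz']] := iz.
exists (z' \oc u0 \oc x), (y' \oc v0 \oc z).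
have zu : z \oc (z' \oc u0 \oc x) = u0 \oc x by rewrite !compmA zz' comp1m.
have yv : y \oc (y' \oc v0 \oc z) = v0 \oc z by rewrite !compmA yy' comp1m.
split.
- apply: (tb_iso hD ix iz iy) d0; split=> //.
  by rewrite compmA -fmapM x2 fmapM -!compmA y3.
- by apply: (iso_cancel_l iz); rewrite compmA zu -compmA x2 compmA ui compmA z2 -!compmA eg.
- by apply: (iso_cancel_l (fmap_iso S ia)); rewrite compmA z3 -compmA zu compmA ku.
- by apply: (iso_cancel_l iy); rewrite compmA yv -compmA z2 compmA vk y2.
- apply: (iso_cancel_l (fmap_iso S ib)).
  by rewrite compmA y3 -compmA yv compmA jv -compmA -z3 !compmA -!fmapM ef.
Qed.

Lemma triangulated_of_basis : is_additive C -> is_additive_functor S ->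
  is_equivalence S -> is_triangulated D.
Proof.
move=> C_add S_add S_equiv; split=> //.
- move=> X Y Z X' Y' Z' f g h f' g' h' a b c ia ib ic [e1 e2 e3] d.
  have [a' [a'a aa']] := ia; have [b' [b'b bb']] := ib; have [c' [c'c cc']] := ic.
  apply: (tb_iso hD (a := a') (b := b') (c := c')) d; first by exists a.
  + by exists b.
  + by exists c.
  split.
  + by apply: (iso_cancel_r ia); rewrite -!compmA a'a compm1 -e1 compmA b'b comp1m.
  + by apply: (iso_cancel_r ib); rewrite -!compmA b'b compm1 -e2 compmA c'c comp1m.
  by apply: (iso_cancel_r ic); rewrite -!compmA c'c compm1 -e3 compmA -fmapM a'a fmap1 comp1m.
- exact: tb_id hD.
- exact: tb_cone hD.
- by move=> X Y Z f g h; split; [apply: (tb_rotate hD) | apply: triangle_rotate_back].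
- exact: tb_fill hD.
- by move=> X Y Z Z' X' Y' f g i i' j j' k k'; apply: triangle_octahedron.
Qed.

End Triangulation.

(** * The stable category of a Frobenius category *)

Section StableCategory.
Variables (A : preadditive) (E : pair_class A) (hF : is_frobenius E).

Let hX := frobenius_exact hF.
Local Notation st := (stable_mor hF).
Local Notation stab := (stable hF).

Lemma stable_morP (X Y : A) (f g : hom X Y) :
  st f = st g <-> factors_projective E (f - g).
Proof. exact: stable_classP. Qed.

Lemma stable_mor_surj (X Y : A) (f : @hom stab X Y) : exists f0 : hom X Y, f = st f0.
Proof. by elim/(@stable_homP A E hF): f => f; exists f. Qed.

Lemma stable_morM (X Y Z : A) (g : hom Y Z) (f : hom X Y) :
  st (g \oc f) = st g \oc st f.
Proof. by rewrite /= stable_compE. Qed.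

Lemma stable_morD (X Y : A) (f g : hom X Y) : st (f + g) = st f + st g.
Proof. exact: stable_classD. Qed.

Lemma stable_mor0 (X Y : A) : st (0 : hom X Y) = 0.
Proof. by apply: (addrI (st (0 : hom X Y))); rewrite -stable_morD !addr0. Qed.

Lemma stable_mor1 (X : A) : st (idm X) = idm (X : stab).
Proof. by []. Qed.

Lemma stable_morN (X Y : A) (f : hom X Y) : st (- f) = - st f.
Proof. by apply: (addrI (st f)); rewrite -stable_morD !subrr stable_mor0. Qed.

Lemma stable_mor_eq0 (X Y : A) (f : hom X Y) : st f = 0 <-> factors_projective E f.
Proof. by rewrite -(stable_mor0 X Y) stable_morP subr0. Qed.

Lemma stable_mor_injective (X I Y : A) (h : hom I Y) (g : hom X I) :
  injective_ob E I -> st (h \oc g) = 0.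
Proof. by move=> hI; apply/stable_mor_eq0; exists I, h, g; split=> //; apply/(projective_injective hF). Qed.

Lemma stable_zero_object (O : A) : is_zero_object O -> is_zero_object (O : stab).
Proof.
case=> h1 h2; split=> X f g; have [f0 ->] := stable_mor_surj f;
  have [g0 ->] := stable_mor_surj g; congr stable_mor; [exact: h1|exact: h2].
Qed.

Lemma stable_biproduct (X Y S : A) (i1 : hom X S) (i2 : hom Y S)
    (p1 : hom S X) (p2 : hom S Y) : is_biproduct i1 i2 p1 p2 ->
  is_biproduct (st i1) (st i2) (st p1) (st p2).
Proof.
case=> e1 e2 e3 e4 e5; split; rewrite -!stable_morM -?stable_morD.
- by rewrite e1.
- by rewrite e2.
- by rewrite e3 stable_mor0.
- by rewrite e4 stable_mor0.
- by rewrite e5.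
Qed.

Lemma stable_additive : is_additive stab.
Proof.
have [[O hO] hS] := exact_additive hX; split.
  by exists O; apply: stable_zero_object.
move=> X Y; have [S [i1 [i2 [p1 [p2 hb]]]]] := hS X Y.
by exists S, (st i1), (st i2), (st p1), (st p2); apply: stable_biproduct.
Qed.

(** A summand [I] that is injective disappears in the stable category. *)
Lemma stable_biproduct_iso (I Y S : A) (i1 : hom I S) (i2 : hom Y S)
    (p1 : hom S I) (p2 : hom S Y) : is_biproduct i1 i2 p1 p2 -> injective_ob E I ->
  st p2 \oc st i2 = idm (Y : stab) /\ st i2 \oc st p2 = idm (S : stab).
Proof.
move=> hb hI; have [_ _ _ _ e] := stable_biproduct hb.
split; first by rewrite -stable_morM (biproductE hb).
by rewrite -e -(stable_morM i1) stable_mor_injective // add0r.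
Qed.

(** Every morphism of the stable category is represented by an inflation, after
    adding an injective hull of the source to its target. *)
Lemma stable_inflation (X Y : A) (f : @hom stab X Y) :
  exists (Y' : A) (f' : hom X Y') (b : @hom stab Y Y'),
    [/\ inflation E f', is_iso b & b \oc f = st f'].
Proof.
have [f0 ->] := stable_mor_surj f.
have [I [s [hI hs]]] := enough_injectives hF X.
have [S [i1 [i2 [p1 [p2 hb]]]]] := (exact_additive hX).2 I Y.
exists S, (i1 \oc s + i2 \oc f0), (st i2); split.
- exact: (inflation_pair hX _ hb hs).
- by exists (st p2); apply: stable_biproduct_iso hb hI.
- by rewrite stable_morD stable_mor_injective // add0r stable_morM.
Qed.

Lemma conflation_induced (X Y Z X' Y' Z' : A) (i : hom X Y) (p : hom Y Z)
    (i' : hom X' Y') (p' : hom Y' Z') (f : hom X X') (h : hom Y Y') :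
  E i p -> E i' p' -> h \oc i = i' \oc f -> exists g, g \oc p = p' \oc h.
Proof.
move=> hip hip' e; have [_ u] := exact_coker hX hip.
have [|g [eg _]] := u _ (p' \oc h); last by exists g.
by rewrite -compmA e compmA (exact_ker hX hip').1 comp0m.
Qed.

(** If [f = b a] with [a] landing in an injective object, then [a] extends along
    [i], which corrects [h] to a map vanishing on [X]; the corrected map factors
    through [p], so that [g] factors through [J]. *)
Lemma conflation_induced_stable0 (X Y Z X' J Z' : A) (i : hom X Y) (p : hom Y Z)
    (i' : hom X' J) (p' : hom J Z') (f : hom X X') (h : hom Y J) (g : hom Z Z') :
  E i p -> E i' p' -> injective_ob E J ->
  h \oc i = i' \oc f -> g \oc p = p' \oc h -> st f = 0 -> st g = 0.
Proof.
move=> hip hip' hJ eh eg /stable_mor_eq0 [P [b [a [hP ef]]]].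
have hi : inflation E i by exists Z, p.
have [a' ea] := (projective_injective hF P).1 hP _ _ i hi a.
have [_ u] := exact_coker hX hip.
have [|t [et _]] := u _ (h - i' \oc b \oc a').
  by rewrite compmBl eh ef -!compmA ea subrr.
rewrite (_ : g = p' \oc t) ?stable_mor_injective //.
apply: (cokernel_epi (exact_coker hX hip)).
by rewrite eg -compmA et compmBr !compmA (exact_ker hX hip').1 !comp0m subr0.
Qed.

(** What a morphism of conflations induces on cokernels depends, in the stable
    category, only on the stable class of the morphism it starts from: this makes
    the suspension a functor. *)
Lemma conflation_induced_stable (X Y Z X' J Z' : A) (i : hom X Y) (p : hom Y Z)
    (i' : hom X' J) (p' : hom J Z') (f1 f2 : hom X X') (h1 h2 : hom Y J)
    (g1 g2 : hom Z Z') :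
  E i p -> E i' p' -> injective_ob E J ->
  h1 \oc i = i' \oc f1 -> g1 \oc p = p' \oc h1 ->
  h2 \oc i = i' \oc f2 -> g2 \oc p = p' \oc h2 -> st f1 = st f2 -> st g1 = st g2.
Proof.
move=> hip hip' hJ eh1 eg1 eh2 eg2 e; apply/eqP; rewrite -subr_eq0 -stable_morN -stable_morD.
apply/eqP; apply: (conflation_induced_stable0 (f := f1 - f2) (h := h1 - h2) hip hip' hJ).
- by rewrite compmBl compmBr eh1 eh2.
- by rewrite compmBl compmBr eg1 eg2.
- by rewrite stable_morD stable_morN e subrr.
Qed.

(** * The suspension functor *)

Section ChoiceOfSuspension.

Record cosyzygy (X : A) := Cosyzygy {
  cosyzygy_inj : A;
  cosyzygy_ob : A;
  cosyzygy_i : hom X cosyzygy_inj;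
  cosyzygy_p : hom cosyzygy_inj cosyzygy_ob;
  cosyzygy_injective : injective_ob E cosyzygy_inj;
  cosyzygy_conflation : E cosyzygy_i cosyzygy_p }.

Lemma cosyzygy_exists (X : A) : exists c : cosyzygy X, True.
Proof.
have [I [i [hI [Z [p hp]]]]] := enough_injectives hF X.
by exists (Cosyzygy hI hp).
Qed.

Definition chosen_cosyzygy (X : A) : cosyzygy X := sval (cid (cosyzygy_exists X)).

Local Notation I X := (cosyzygy_inj (chosen_cosyzygy X)).
Local Notation SX X := (cosyzygy_ob (chosen_cosyzygy X)).
Local Notation ii X := (cosyzygy_i (chosen_cosyzygy X)).
Local Notation pp X := (cosyzygy_p (chosen_cosyzygy X)).

Lemma cosyzygy_map_exists (X Y : A) (f : hom X Y) :
  exists g : hom (SX X) (SX Y), exists h, h \oc ii X = ii Y \oc f /\ g \oc pp X = pp Y \oc h.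
Proof.
have cX := cosyzygy_conflation (chosen_cosyzygy X).
have cY := cosyzygy_conflation (chosen_cosyzygy Y).
have hi : inflation E (ii X) by exists (SX X), (pp X).
have [h eh] := cosyzygy_injective (c := chosen_cosyzygy Y) hi (ii Y \oc f).
by have [g eg] := conflation_induced cX cY eh; exists g, h.
Qed.

Definition cosyzygy_map (X Y : A) (f : hom X Y) : hom (SX X) (SX Y) :=
  sval (cid (cosyzygy_map_exists f)).

Definition suspension_map (X Y : stab) (f : hom X Y) : @hom stab (SX X) (SX Y) :=
  st (cosyzygy_map (repr f)).

Lemma suspension_mapE (X Y : A) (f : hom X Y) (h : hom (I X) (I Y)) (g : hom (SX X) (SX Y)) :
  h \oc ii X = ii Y \oc f -> g \oc pp X = pp Y \oc h ->
  suspension_map (st f) = st g.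
Proof.
move=> eh eg; rewrite /suspension_map /cosyzygy_map.
case: (cid _) => g' /= [h' [eh' eg']].
have cX := cosyzygy_conflation (chosen_cosyzygy X).
have cY := cosyzygy_conflation (chosen_cosyzygy Y).
apply: (conflation_induced_stable cX cY (@cosyzygy_injective _ _) eh' eg' eh eg).
exact: reprK.
Qed.

Lemma suspension_map1 (X : stab) : suspension_map (idm X) = idm (SX X : stab).
Proof.
by rewrite -stable_mor1 (@suspension_mapE _ _ _ (idm _) (idm _)) // ?comp1m ?compm1.
Qed.

Lemma suspension_mapM (X Y Z : stab) (g : hom Y Z) (f : hom X Y) :
  suspension_map (g \oc f) = suspension_map g \oc suspension_map f.
Proof.
have [f0 ->] := stable_mor_surj f; have [g0 ->] := stable_mor_surj g.
have [f1 [f2 [e1 e2]]] := cosyzygy_map_exists f0.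
have [g1 [g2 [e3 e4]]] := cosyzygy_map_exists g0.
rewrite -stable_morM (suspension_mapE e1 e2) (suspension_mapE e3 e4) -stable_morM.
apply: (@suspension_mapE _ _ _ (g2 \oc f2)); first by rewrite -compmA e1 !compmA e3.
by rewrite -compmA e2 !compmA e4.
Qed.

Definition suspension : functor stab stab :=
  @Functor stab stab (fun X => SX X) suspension_map suspension_map1 suspension_mapM.

Definition suspension_cosyzygy : cosyzygy_suspension suspension :=
  @CosyzygySuspension A E hF suspension (fun X => I X) (fun X => ii X) (fun X => pp X)
    (fun X => @cosyzygy_injective X (chosen_cosyzygy X))
    (fun X => cosyzygy_conflation (chosen_cosyzygy X)) suspension_mapE.

End ChoiceOfSuspension.

Variables (S : functor stab stab) (sD : cosyzygy_suspension S).

Local Notation I := (susp_inj sD).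
Local Notation ii := (susp_i sD).
Local Notation pp := (susp_p sD).

Lemma susp_infl (X : A) : inflation E (ii X).
Proof. by exists (S X), (pp X); apply: susp_conflation. Qed.

Lemma susp_lift (X Y : A) (f : hom X Y) : exists (h : hom (I X) (I Y)) (g : @hom A (S X) (S Y)),
  [/\ h \oc ii X = ii Y \oc f, g \oc pp X = pp Y \oc h & fmap S (st f) = st g].
Proof.
have [h eh] := susp_injective (c := sD) (susp_infl X) (ii Y \oc f).
have [g eg] := conflation_induced (susp_conflation sD X) (susp_conflation sD Y) eh.
by exists h, g; split=> //; apply: susp_fmap eg.
Qed.

Lemma susp_additive : is_additive_functor S.
Proof.
move=> X Y f g; have [f0 ->] := stable_mor_surj f; have [g0 ->] := stable_mor_surj g.
have [h1 [k1 [e1 e2 ->]]] := susp_lift f0; have [h2 [k2 [e3 e4 ->]]] := susp_lift g0.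
rewrite -!stable_morD; apply: (susp_fmap (h := h1 + h2)).
  by rewrite compmDl compmDr e1 e3.
by rewrite compmDl compmDr e2 e4.
Qed.

(** If [S f] factors through a projective [P], lift the map out of [P] along
    the deflation onto [S Y]: this corrects the extension of [f] to a map that
    factors through [Y], hence [f] extends to the injective [I X]. *)
Lemma susp_faithful : faithful S.
Proof.
have key (X Y : A) (f : hom X Y) : fmap S (st f) = 0 -> st f = 0.
  have [h [g [eh eg ->]]] := susp_lift f => /stable_mor_eq0 [P [b [a [hP eP]]]].
  have [|b' eb] := hP _ _ (pp Y) _ b; first by exists Y, (ii Y); apply: susp_conflation.
  have kY := exact_ker hX (susp_conflation sD Y).
  have kX := exact_ker hX (susp_conflation sD X).
  have [|t [et _]] := kY.2 _ (h - b' \oc a \oc pp X).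
    by rewrite compmBr -eg eP !compmA eb subrr.
  rewrite (_ : f = t \oc ii X) ?stable_mor_injective //; first exact: susp_injective.
  apply: (kernel_mono kY).
  by rewrite compmA et compmBl eh -(compmA _ (pp X)) kX.1 compm0 subr0.
move=> X Y f g; have [f0 ->] := stable_mor_surj f; have [g0 ->] := stable_mor_surj g.
move=> e; apply/eqP; rewrite -subr_eq0 -stable_morN -stable_morD; apply/eqP/key.
by apply: (addIr (fmap S (st g0))); rewrite -susp_additive -stable_morD subrK add0r.
Qed.

(** A map between suspensions lifts to the injective hulls, which are
    projective, and then restricts to the kernels of [susp_p]. *)
Lemma susp_full : full S.
Proof.
move=> X Y g; have [g0 ->] := stable_mor_surj g.
have [|h eh] := (projective_injective hF (I X)).2 (@susp_injective _ _ _ _ sD X) _ _ (pp Y) _ (g0 \oc pp X).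
  by exists Y, (ii Y); apply: susp_conflation.
have kY := exact_ker hX (susp_conflation sD Y).
have kX := exact_ker hX (susp_conflation sD X).
have [|f [ef _]] := kY.2 _ (h \oc ii X); first by rewrite compmA eh -compmA kX.1 compm0.
by exists (st f); apply: (susp_fmap (h := h)).
Qed.

(** The identity of [X] extends to maps of conflations both ways, and the maps
    induced on cokernels are mutually inverse in the stable category because
    they are determined there by their restriction to [X]. *)
Lemma stable_iso_of_cosyzygies (X I1 Z1 I2 Z2 : A) (i1 : hom X I1) (p1 : hom I1 Z1)
    (i2 : hom X I2) (p2 : hom I2 Z2) :
  E i1 p1 -> E i2 p2 -> injective_ob E I1 -> injective_ob E I2 ->
  exists a : @hom stab Z1 Z2, is_iso a.
Proof.
move=> h1 h2 hI1 hI2.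
have [|h eh] := hI2 _ _ i1 _ (i2 \oc idm X); first by exists Z1, p1.
have [g eg] := conflation_induced h1 h2 eh.
have [|h' eh'] := hI1 _ _ i2 _ (i1 \oc idm X); first by exists Z2, p2.
have [g' eg'] := conflation_induced h2 h1 eh'.
exists (st g), (st g'); rewrite -!stable_morM -!stable_mor1; split.
  apply: (conflation_induced_stable h1 h1 hI1 (h1 := h' \oc h) (f1 := idm X \oc idm X)
    (h2 := idm I1) (f2 := idm X)); rewrite ?compm1 ?comp1m //.
  - by rewrite -compmA eh compm1 eh' compm1.
  - by rewrite -compmA eg !compmA eg'.
apply: (conflation_induced_stable h2 h2 hI2 (h1 := h \oc h') (f1 := idm X \oc idm X)
    (h2 := idm I2) (f2 := idm X)); rewrite ?compm1 ?comp1m //.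
- by rewrite -compmA eh' compm1 eh compm1.
- by rewrite -compmA eg' !compmA eg.
Qed.

Lemma susp_ess_surjective : ess_surjective S.
Proof.
move=> Z; have [P [p [hP [K [i hi]]]]] := enough_projectives hF Z.
have [|a ia] := stable_iso_of_cosyzygies (susp_conflation sD K) hi (@susp_injective _ _ _ _ sD K).
  exact/(projective_injective hF).
by exists K, a.
Qed.

Lemma susp_equivalence : is_equivalence S.
Proof.
exact: equivalence_of_fully_faithful susp_faithful susp_full susp_ess_surjective.
Qed.

(** * The triangles induced by conflations *)

Lemma conflation_connecting (X Y Z : A) (i : hom X Y) (p : hom Y Z) : E i p ->
  exists (u : hom Y (I X)) (w : @hom A Z (S X)), u \oc i = ii X /\ w \oc p = pp X \oc u.
Proof.
move=> hip; have hi : inflation E i by exists Z, p.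
have [u eu] := susp_injective (c:=sD) hi (ii X).
have [|w ew] := conflation_induced hip (susp_conflation sD X) (f := idm X) (h := u).
  by rewrite compm1.
by exists u, w.
Qed.

Lemma conflation_triangle (X Y Z : A) (i : hom X Y) (p : hom Y Z)
    (u : hom Y (I X)) (w : @hom A Z (S X)) :
  E i p -> u \oc i = ii X -> w \oc p = pp X \oc u ->
  stable_triangle sD (st i) (st p) (st w).
Proof.
move=> hip eu ew; exists X, Y, Z, i, p, u, w, (idm _), (idm _), (idm _); split=> //.
  by split; apply: is_iso_id.
by split; rewrite ?fmap1 ?comp1m ?compm1.
Qed.

(** The two maps from [Y] to the injective hull of [X'] obtained from the
    square agree on [X], so that their difference factors through [p]. *)
Lemma conflation_triangle_morphism (X Y Z X' Y' Z' : A)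
    (i : hom X Y) (p : hom Y Z) (u : hom Y (I X)) (w : @hom A Z (S X))
    (i' : hom X' Y') (p' : hom Y' Z') (u' : hom Y' (I X')) (w' : @hom A Z' (S X'))
    (a : hom X X') (b : hom Y Y') (c : hom Z Z') :
  E i p -> u \oc i = ii X -> w \oc p = pp X \oc u ->
  E i' p' -> u' \oc i' = ii X' -> w' \oc p' = pp X' \oc u' ->
  b \oc i = i' \oc a -> c \oc p = p' \oc b ->
  fmap S (st a) \oc st w = st w' \oc st c.
Proof.
move=> hip eu ew hip' eu' ew' eb ec.
have [h [g [eh eg ->]]] := susp_lift a.
have [_ k] := exact_coker hX hip.
have [|t [et _]] := k _ (h \oc u - u' \oc b).
  by rewrite compmBl -!compmA eu eb eh (compmA u') eu' subrr.
apply/eqP; rewrite -subr_eq0 -!stable_morM -stable_morN -stable_morD.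
rewrite (_ : _ - _ = pp X' \oc t) ?stable_mor_injective //; first exact: susp_injective.
apply: (cokernel_epi (exact_coker hX hip)).
rewrite compmBl -!compmA et ec ew compmBr !compmA eg ew'.
by rewrite -!compmA.
Qed.

Lemma stable_triangle_iso (X Y Z X' Y' Z' : stab)
    (f : hom X Y) (g : hom Y Z) (h : hom Z (S X))
    (f' : hom X' Y') (g' : hom Y' Z') (h' : hom Z' (S X'))
    (a : hom X X') (b : hom Y Y') (c : hom Z Z') :
  is_iso a -> is_iso b -> is_iso c -> triangle_morphism f g h f' g' h' a b c ->
  stable_triangle sD f' g' h' -> stable_triangle sD f g h.
Proof.
move=> ia ib ic [e1 e2 e3].
move=> [X0 [Y0 [Z0 [i [p [u [w [a' [b' [c' [hip eu ew [ia' ib' ic'] [e1' e2' e3']]]]]]]]]]]].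
exists X0, Y0, Z0, i, p, u, w, (a' \oc a), (b' \oc b), (c' \oc c); split=> //.
  by split; apply: is_iso_comp.
split; first by rewrite -compmA e1 !compmA e1'.
  by rewrite -compmA e2 !compmA e2'.
by rewrite fmapM -compmA e3 !compmA e3'.
Qed.

Lemma stable_triangle_id (X Z : stab) :
  is_zero_object Z -> stable_triangle sD (idm X) (0 : hom X Z) 0.
Proof.
move=> hZ; have [[O hO] _] := exact_additive hX.
have [hZ1 hZ2] := hZ; have [hO1 hO2] := stable_zero_object hO.
exists X, X, O, (@idm A X), (0 : @hom A X O), (ii X), 0, (idm _), (idm _), 0; split.
- exact: conflation_id.
- by rewrite compm1.
- by rewrite comp0m (exact_ker hX (susp_conflation sD X)).1.
- split; [exact: is_iso_id|exact: is_iso_id|exists 0].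
  by split; [apply: hZ1|apply: hO1].
- split; first by rewrite stable_mor1.
    by apply: hO1.
  by rewrite compm0 stable_mor0 comp0m.
Qed.

Lemma stable_triangle_cone (X Y : stab) (f : hom X Y) :
  exists (Z : stab) (g : hom Y Z) (h : hom Z (S X)), stable_triangle sD f g h.
Proof.
have [Y' [f' [b [[Z [p hp]] ib e]]]] := stable_inflation f.
have [u [w [eu ew]]] := conflation_connecting hp.
exists Z, (st p \oc b), (st w).
apply: (stable_triangle_iso (is_iso_id _) ib (is_iso_id _)) (conflation_triangle hp eu ew).
by split; rewrite ?fmap1 ?comp1m ?compm1.
Qed.

Lemma conflation_triangle_fill (X Y Z X' Y' Z' : A)
    (i : hom X Y) (p : hom Y Z) (u : hom Y (I X)) (w : @hom A Z (S X))
    (i' : hom X' Y') (p' : hom Y' Z') (u' : hom Y' (I X')) (w' : @hom A Z' (S X'))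
    (a : @hom stab X X') (b : @hom stab Y Y') :
  E i p -> u \oc i = ii X -> w \oc p = pp X \oc u ->
  E i' p' -> u' \oc i' = ii X' -> w' \oc p' = pp X' \oc u' ->
  b \oc st i = st i' \oc a ->
  exists c, triangle_morphism (st i) (st p) (st w) (st i') (st p') (st w') a b c.
Proof.
move=> hip eu ew hip' eu' ew'.
have [a0 ->] := stable_mor_surj a; have [b0 ->] := stable_mor_surj b => e.
have hi : inflation E i by exists Z, p.
move: (e); rewrite -!stable_morM => /stable_morP [P [k [l [hP ekl]]]].
have [l' el] := (projective_injective hF P).1 hP _ _ i hi l.
(* [b0] modified by a map through [P] so that the square commutes strictly *)
have eb : (b0 - k \oc l') \oc i = i' \oc a0.
  by rewrite compmBl -compmA el -ekl opprB addrC subrK.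
have [c ec] := conflation_induced hip hip' eb.
exists (st c); split=> //; last exact: (conflation_triangle_morphism hip eu ew hip' eu' ew' eb ec).
rewrite -!stable_morM ec compmBr compmA stable_morD stable_morN.
by rewrite (stable_mor_injective (p' \oc k) l') ?subr0 //; apply/(projective_injective hF).
Qed.

Lemma stable_triangle_fill (X Y Z X' Y' Z' : stab)
    (f : hom X Y) (g : hom Y Z) (h : hom Z (S X))
    (f' : hom X' Y') (g' : hom Y' Z') (h' : hom Z' (S X'))
    (a : hom X X') (b : hom Y Y') :
  stable_triangle sD f g h -> stable_triangle sD f' g' h' -> b \oc f = f' \oc a ->
  exists c : hom Z Z', triangle_morphism f g h f' g' h' a b c.
Proof.
move=> [X0 [Y0 [Z0 [i [p [u [w [a0 [b0 [c0 [hip eu ew [ia ib ic] [e1 e2 e3]]]]]]]]]]]].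
move=> [X1 [Y1 [Z1 [j [q [v [x [a1 [b1 [c1 [hjq ev ex [ia' ib' ic'] [e1' e2' e3']]]]]]]]]]]].
move=> e; have [a0' [aa1 aa2]] := ia; have [b0' [bb1 bb2]] := ib.
have [|c [_ ec1 ec2]] := conflation_triangle_fill (a := a1 \oc a \oc a0') (b := b1 \oc b \oc b0')
    hip eu ew hjq ev ex.
  apply: (iso_cancel_r ia); rewrite -!compmA -e1 aa1 compm1.
  by rewrite (compmA b0') bb1 comp1m e !compmA e1'.
have [c1' [cc1 cc2]] := ic'.
exists (c1' \oc c \oc c0); split=> //.
  apply: (iso_cancel_l ic'); rewrite !compmA cc2 comp1m e2' -!compmA e2.
  by rewrite (compmA c) ec1 -!compmA bb1 compm1.
apply: (iso_cancel_l (fmap_iso S ia')).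
rewrite (compmA _ h') e3' -!compmA (compmA c1) cc2 comp1m (compmA _ c) -ec2.
by rewrite -compmA -e3 !compmA -!fmapM -!compmA aa1 compm1.
Qed.

(** The square of [p], [susp_p], [u] and [w] is a pullback, so that
    [Y -> Z + I X -> S X] is a conflation; an extension of [susp_i] from [Y] to
    the middle term restricts on [I X] to an extension of [susp_i \oc i], by
    which the connecting morphism is [- S i]. *)
Lemma conflation_triangle_rotate (X Y Z : A) (i : hom X Y) (p : hom Y Z)
    (u : hom Y (I X)) (w : @hom A Z (S X)) :
  E i p -> u \oc i = ii X -> w \oc p = pp X \oc u ->
  stable_triangle sD (st p) (st w) (- fmap S (st i)).
Proof.
move=> hip eu ew.
have [T [i1 [i2 [p1 [p2 hb]]]]] := (exact_additive hX).2 (I X) Z.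
have hq : deflation E (- pp X \oc p1 + w \oc p2).
  apply: (deflation_copair hX _ hb).
  have iN : is_iso (- idm (I X)).
    by exists (- idm (I X)); rewrite !compm_unit opprK.
  rewrite -[- pp X]compm1 compNm -compmN.
  by apply: (deflation_iso_r hX iN); exists X, (ii X); apply: susp_conflation.
have [e k] := pullback_of_same_kernel hX hip (susp_conflation sD X) eu ew.
have hk : is_kernel (i1 \oc u + i2 \oc p) (- pp X \oc p1 + w \oc p2).
  split.
    rewrite !compmDl !compmDr -!compmA !(biproductE hb) !compm_unit.
    by rewrite ew addrC subrr.
  move=> W t et.
  have [|s [[e1 e2] us]] := k _ (p1 \oc t) (p2 \oc t).
    apply/eqP; rewrite -subr_eq0 -oppr_eq0 opprB -et; apply/eqP.
    by rewrite !compmDl !compNm -!compmA addrC.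
  exists s; split.
    by rewrite compmDl -!compmA e1 e2 (biproduct_sum hb).
  move=> s' es; apply: us; rewrite -es.
  by rewrite !compmDl !compmDr -!compmA !(biproductE hb) !compm_unit.
have hc := deflation_ker_conflation hX hq hk.
have [v [x [ev ex]]] := conflation_connecting hc.
have [bi1 bi2] := stable_biproduct_iso hb (@susp_injective _ _ _ _ sD X).
have Si : fmap S (st i) = st (- x).
  apply: (susp_fmap (h := v \oc i1)).
    rewrite -ev -!compmA compmDl -!compmA eu.
    by rewrite (exact_ker hX hip).1 !compm_unit.
  rewrite compmA -ex -compmA !compmDl -!compmA !(biproductE hb).
  by rewrite !compm_unit.
rewrite Si stable_morN opprK.
apply: (stable_triangle_iso (a := idm _) (b := st i2) (c := idm _)) (conflation_triangle hc ev ex).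
- exact: is_iso_id.
- by exists (st p2).
- exact: is_iso_id.
split; rewrite ?fmap1 ?comp1m ?compm1 //.
  rewrite stable_morD stable_mor_injective ?add0r ?stable_morM //.
  exact: susp_injective.
by rewrite -stable_morM !compmDl -!compmA !(biproductE hb) !compm_unit.
Qed.

Lemma stable_triangle_rotate (X Y Z : stab) (f : hom X Y) (g : hom Y Z) (h : hom Z (S X)) :
  stable_triangle sD f g h -> stable_triangle sD g h (- fmap S f).
Proof.
move=> [X0 [Y0 [Z0 [i [p [u [w [a [b [c [hip eu ew [ia ib ic] [e1 e2 e3]]]]]]]]]]]].
apply: (stable_triangle_iso ib ic (fmap_iso S ia)) (conflation_triangle_rotate hip eu ew).
by split=> //; rewrite compmN compNm -!fmapM e1.
Qed.

(** For composable inflations the octahedron is made of the three cokernels, and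
    its commutativities are morphisms of conflations. *)
Lemma stable_triangle_octahedron (X Y Z : stab) (f : hom X Y) (g : hom Y Z) :
  exists (X0 Y0 Z0 : stab) (f0 : hom X0 Y0) (g0 : hom Y0 Z0)
    (a : hom X X0) (b : hom Y Y0) (c : hom Z Z0),
  [/\ is_iso a, is_iso b & is_iso c] /\ b \oc f = f0 \oc a /\ c \oc g = g0 \oc b /\
  exists Z' X' Y' (i : hom Y0 Z') i' (j : hom Z0 X') j' (k : hom Z0 Y') k',
  [/\ stable_triangle sD f0 i i', stable_triangle sD g0 j j',
      stable_triangle sD (g0 \oc f0) k k'
    & octahedron (stable_triangle sD) f0 g0 i i' j j' k k'].
Proof.
have [Y1 [f1 [b [hf ib ef]]]] := stable_inflation f.
have [b' [b'b bb']] := ib.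
have [Z1 [g1 [c [hg ic eg]]]] := stable_inflation (g \oc b').
exists X, Y1, Z1, (st f1), (st g1), (idm _), b, c.
split; first by split=> //; apply: is_iso_id.
split; first by rewrite compm1.
split; first by rewrite -eg -!compmA b'b compm1.
have [Z' [i hi]] := hf; have [X' [j hj]] := hg.
have [Y' [k hk]] := exact_inflM hX hf hg.
have [|u eu] := conflation_induced hi hk (f := idm _) (h := g1); first by rewrite compm1.
have [|v ev] := conflation_induced hk hj (f := f1) (h := idm _); first by rewrite comp1m.
rewrite compm1 in ev.
have huv := conflation_noether hX hi hj hk eu ev.
have [ui [wi [ei1 ei2]]] := conflation_connecting hi.
have [uj [wj [ej1 ej2]]] := conflation_connecting hj.
have [uk [wk [ek1 ek2]]] := conflation_connecting hk.
have [uv [wv [ev1 ev2]]] := conflation_connecting huv.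
exists Z', X', Y', (st i), (st wi), (st j), (st wj), (st k), (st wk); split.
- exact: conflation_triangle hi ei1 ei2.
- exact: conflation_triangle hj ej1 ej2.
- by rewrite -stable_morM; apply: conflation_triangle hk ek1 ek2.
exists (st u), (st v); split.
- have <- : st wv = fmap S (st i) \oc st wj.
    rewrite (conflation_triangle_morphism hj ej1 ej2 huv ev1 ev2 (b := k) (c := idm _)).
    + by rewrite stable_mor1 compm1.
    + by rewrite eu.
    + by rewrite comp1m ev.
  exact: conflation_triangle huv ev1 ev2.
- by rewrite -!stable_morM eu.
- rewrite -(conflation_triangle_morphism hi ei1 ei2 hk ek1 ek2 (a := idm _) (b := g1)) //.
    by rewrite stable_mor1 fmap1 comp1m.
  by rewrite compm1.
- by rewrite -!stable_morM ev.
- rewrite -(conflation_triangle_morphism hk ek1 ek2 hj ej1 ej2 (a := f1) (b := idm _)) //.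
    by rewrite comp1m.
  by rewrite compm1.
Qed.

Lemma stable_triangulated : is_triangulated (stable_triangle sD).
Proof.
apply: triangulated_of_basis; last exact: susp_equivalence.
- split.
  + exact: susp_faithful.
  + exact: susp_full.
  + exact: stable_triangle_iso.
  + by have [[Z hZ] _] := stable_additive; exists Z.
  + exact: stable_triangle_id.
  + exact: stable_triangle_cone.
  + exact: stable_triangle_rotate.
  + exact: stable_triangle_fill.
  + exact: stable_triangle_octahedron.
- exact: stable_additive.
- exact: susp_additive.
Qed.

End StableCategory.

(** * Kernels and pullbacks under an equivalence *)

Section FunctorLimits.
Variables (A : preadditive) (T : functor A A) (T_equiv : is_equivalence T).

Let T_faithful := equivalence_faithful T_equiv.
Let T_full := equivalence_full T_equiv.
Let T_es := equivalence_ess_surjective T_equiv.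

Lemma fmap_kernel (X Y Z : A) (k : hom X Y) (g : hom Y Z) :
  is_additive_functor T -> is_kernel k g -> is_kernel (fmap T k) (fmap T g).
Proof.
move=> T_add hk; have [gk u] := hk.
split=> [|W t]; first by rewrite -fmapM gk fmap_add0.
have [V [e ie]] := T_es W; have [e' [e'e ee']] := ie.
have [t' et] := T_full (t \oc e) => gt.
have [|s [es us]] := u _ t'.
  by apply: T_faithful; rewrite fmapM et compmA gt comp0m fmap_add0.
exists (fmap T s \oc e'); split.
  by rewrite compmA -fmapM es et -compmA ee' compm1.
move=> r er; have [r' er'] := T_full (r \oc e).
apply: (iso_cancel_r ie); rewrite -compmA e'e compm1 -er'; congr fmap.
by apply: us; apply: T_faithful; rewrite fmapM er' et compmA er.
Qed.

Lemma fmap_pullback (Y Z Y' Z' : A) (p : hom Y Z) (f : hom Z' Z)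
    (f' : hom Y' Y) (p' : hom Y' Z') :
  is_pullback p f f' p' -> is_pullback (fmap T p) (fmap T f) (fmap T f') (fmap T p').
Proof.
move=> [e0 k]; split=> [|W u v]; first by rewrite -!fmapM e0.
have [V [e ie]] := T_es W; have [e' [e'e ee']] := ie.
have [u' eu] := T_full (u \oc e); have [v' ev] := T_full (v \oc e) => euv.
have [|s [[e1 e2] us]] := k _ u' v'.
  by apply: T_faithful; rewrite !fmapM eu ev !compmA euv.
exists (fmap T s \oc e'); split.
  by rewrite !compmA -!fmapM e1 e2 eu ev -!compmA ee' !compm1.
move=> r [er1 er2]; have [r' er'] := T_full (r \oc e).
apply: (iso_cancel_r ie); rewrite -compmA e'e compm1 -er'; congr fmap.
by apply: us; split; apply: T_faithful; rewrite fmapM er' ?eu ?ev compmA ?er1 ?er2.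
Qed.

End FunctorLimits.

(** * Composites along a factorization *)

Section Composites.
Variables (n : nat) (A : preadditive).

Section OneFamily.
Variables (X : 'I_n -> A) (d : forall i j : 'I_n, j = i.+1 :> nat -> hom (X i) (X j)).

Lemma path_comp_ind (i : 'I_n) (Q : forall j, hom (X i) (X j) -> Prop) :
  Q i (idm (X i)) ->
  (forall (l j : 'I_n) (e : j = l.+1 :> nat) f, (i <= l)%N -> Q l f -> Q j (d e \oc f)) ->
  forall (j : 'I_n) (h : (i <= j)%N), Q j (path_comp d h).
Proof.
move=> Q1 QS j h; rewrite /path_comp; move: (j - i)%N (esym _) => {h} k.
elim: k j => [|k IH] j e /=; last by apply: QS => //=; apply: leq_addl.
by move: (ord_inj (esym e)) => {e} e; case: j / e.
Qed.

Lemma path_stepsS (k : nat) (i l j : 'I_n) (e : j = l.+1 :> nat)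
    (el : l = (k + i)%N :> nat) (ej : j = (k.+1 + i)%N :> nat) :
  path_steps d ej = d e \oc path_steps d el.
Proof.
have eO : l = Ordinal (path_bound ej) by apply: val_inj.
subst l; rewrite /= (eq_irrelevance el erefl); congr (_ \oc _).
by congr d; apply: eq_irrelevance.
Qed.

Lemma path_comp_steps (k : nat) (i j : 'I_n) (e : j = (k + i)%N :> nat) (h : (i <= j)%N) :
  path_comp d h = path_steps d e.
Proof.
have ek : (j - i)%N = k by rewrite e addnK.
rewrite /path_comp; case: k / ek e => e.
by congr path_steps; apply: eq_irrelevance.
Qed.

(** The composite from [i] to [j], set to zero when [j < i] so as not to carry
    a proof of [i <= j]. *)
Definition path_map (i j : 'I_n) : hom (X i) (X j) :=
  if @idP (i <= j)%N is ReflectT h then path_comp d h else 0.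

Lemma path_mapE (i j : 'I_n) (h : (i <= j)%N) : path_map i j = path_comp d h.
Proof.
by rewrite /path_map; case: {-}_ / idP => [h'|//]; congr path_comp; apply: bool_irrelevance.
Qed.

Lemma path_map_id (i : 'I_n) : path_map i i = idm (X i).
Proof.
rewrite (path_mapE (leqnn i)) (@path_comp_steps 0 i i erefl) /=.
by rewrite (eq_axiomK (ord_inj _)).
Qed.

Lemma path_mapS (i l j : 'I_n) (e : j = l.+1 :> nat) :
  (i <= l)%N -> path_map i j = d e \oc path_map i l.
Proof.
move=> h; have h' : (i <= j)%N by rewrite e leqW.
have ek : j = ((l - i).+1 + i)%N :> nat by rewrite addSn subnK.
have el : l = (l - i + i)%N :> nat by rewrite subnK.
rewrite (path_mapE h') (path_mapE h) (path_comp_steps ek) (path_comp_steps el).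
exact: path_stepsS.
Qed.

Lemma path_map_ind (i : 'I_n) (Q : forall j, hom (X i) (X j) -> Prop) :
  Q i (idm (X i)) ->
  (forall (l j : 'I_n) (e : j = l.+1 :> nat) f, (i <= l)%N -> Q l f -> Q j (d e \oc f)) ->
  forall j : 'I_n, (i <= j)%N -> Q j (path_map i j).
Proof. by move=> Q1 QS j h; rewrite (path_mapE h); apply: path_comp_ind. Qed.

Lemma path_map_cat (i l j : 'I_n) :
  (i <= l)%N -> (l <= j)%N -> path_map l j \oc path_map i l = path_map i j.
Proof.
move=> hil; move: j; apply: (path_map_ind (Q := fun j x => x \oc path_map i l = path_map i j))
  => [|a b e f hla ef]; first by rewrite comp1m.
by rewrite (path_mapS e (leq_trans hil hla)) -compmA ef.
Qed.

Lemma path_map1 (i j : 'I_n) (e : j = i.+1 :> nat) : path_map i j = d e.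
Proof. by rewrite (path_mapS e (leqnn i)) path_map_id compm1. Qed.

Lemma path_map_cons (i l j : 'I_n) (e : l = i.+1 :> nat) :
  (l <= j)%N -> path_map i j = path_map l j \oc d e.
Proof. by move=> h; rewrite -(path_map1 e) path_map_cat // e. Qed.

End OneFamily.

Lemma path_map_natural (X Y : 'I_n -> A)
    (dX : forall i j : 'I_n, j = i.+1 :> nat -> hom (X i) (X j))
    (dY : forall i j : 'I_n, j = i.+1 :> nat -> hom (Y i) (Y j))
    (f : forall j, hom (X j) (Y j)) :
  (forall (i j : 'I_n) (e : j = i.+1 :> nat), f j \oc dX i j e = dY i j e \oc f i) ->
  forall i j : 'I_n, (i <= j)%N -> f j \oc path_map dX i j = path_map dY i j \oc f i.
Proof.
move=> fE i.
apply: (path_map_ind (Q := fun j x => f j \oc x = path_map dY i j \oc f i))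
  => [|l j e f' h IH].
  by rewrite path_map_id comp1m compm1.
by rewrite compmA fE -compmA IH compmA (path_mapS dY e h).
Qed.
End Composites.

(** * Constructing factorizations *)

Section Factorizations.
Variables (n : nat) (n_gt1 : (1 < n)%N) (A : preadditive) (T : functor A A).
Variable w : nat_trans (id_functor A) T.

Local Notation o := (ord_first n_gt1).
Local Notation l := (ord_last n_gt1).

Section Loop.
Variables (X : 'I_n -> A) (d : forall i j : 'I_n, j = i.+1 :> nat -> hom (X i) (X j)).
Variable dl : hom (X l) (T (X o)).

(** Once around the sequence, starting from [j]. *)
Definition loop (j : 'I_n) : hom (X j) (T (X j)) :=
  fmap T (path_map d o j) \oc dl \oc path_map d j l.

Hypothesis loopE : forall j, loop j = w (X j).

Fact fact_of_loop0 : dl \oc path_comp d (le_ord_last n_gt1 o) = w (X o).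
Proof. by rewrite -loopE /loop path_map_id fmap1 comp1m (path_mapE d (le_ord_last n_gt1 o)). Qed.

Fact fact_of_loopj (j : 'I_n) : (0 < j)%N ->
  fmap T (path_comp d (ord_first_le n_gt1 j)) \oc dl \oc path_comp d (le_ord_last n_gt1 j)
  = w (X j).
Proof.
by rewrite -loopE /loop (path_mapE d (le_ord_last n_gt1 j)) (path_mapE d (ord_first_le n_gt1 j)).
Qed.

Definition fact_of_loop : factorization n_gt1 w := Factorization fact_of_loop0 fact_of_loopj.

End Loop.

Lemma loop_fact (X : factorization n_gt1 w) (j : 'I_n) :
  loop (fact_d X) (fact_dlast X) j = w (X j).
Proof.
rewrite /loop; case: (posnP j) => [j0|j0].
  have -> : j = o by apply: val_inj.
  rewrite path_map_id fmap1 comp1m (path_mapE _ (le_ord_last n_gt1 o)).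
  exact: fact_eq0.
by rewrite (path_mapE _ (le_ord_last n_gt1 j)) (path_mapE _ (ord_first_le n_gt1 j)) fact_eq.
Qed.

Lemma loop_natural (X Y : 'I_n -> A)
    (dX : forall i j : 'I_n, j = i.+1 :> nat -> hom (X i) (X j))
    (dY : forall i j : 'I_n, j = i.+1 :> nat -> hom (Y i) (Y j))
    (dlX : hom (X l) (T (X o))) (dlY : hom (Y l) (T (Y o)))
    (f : forall j, hom (X j) (Y j)) :
  (forall (i j : 'I_n) (e : j = i.+1 :> nat), f j \oc dX i j e = dY i j e \oc f i) ->
  fmap T (f o) \oc dlX = dlY \oc f l ->
  forall j, fmap T (f j) \oc loop dX dlX j = loop dY dlY j \oc f j.
Proof.
move=> fE flE j; have pE := path_map_natural fE.
rewrite /loop !compmA -fmapM pE ?ord_first_le // fmapM -!compmA -(pE j l) ?le_ord_last //.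
by rewrite !(compmA _ dlX) flE -!compmA.
Qed.

Lemma fact_path_natural (X Y : factorization n_gt1 w) (f : fact_hom X Y) (i j : 'I_n) :
  (i <= j)%N -> f j \oc path_map (fact_d X) i j = path_map (fact_d Y) i j \oc f i.
Proof. exact: path_map_natural (fact_morE f) i j. Qed.

Section Transport.
Variables (Z : 'I_n -> A) (d : forall i j : 'I_n, j = i.+1 :> nat -> hom (Z i) (Z j)).
Variable dl : hom (Z l) (T (Z o)).

(** The relation satisfied by [Y] holds on [Z] after composition with [p], as
    loops and [w] are both natural. It follows on [Z] itself when the maps used
    are jointly epic. *)
Lemma loop_out (Y : factorization n_gt1 w) (p : forall j, hom (Y j) (Z j)) :
  (forall (i j : 'I_n) (e : j = i.+1 :> nat), p j \oc fact_d Y e = d e \oc p i) ->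
  fmap T (p o) \oc fact_dlast Y = dl \oc p l ->
  forall j, loop d dl j \oc p j = w (Z j) \oc p j.
Proof.
move=> pE plE j; rewrite -(loop_natural pE plE) loop_fact.
by have := nt_natural w (p j) => /= <-.
Qed.

Lemma loop_in (Y : factorization n_gt1 w) (k : forall j, hom (Z j) (Y j)) :
  (forall (i j : 'I_n) (e : j = i.+1 :> nat), k j \oc d e = fact_d Y e \oc k i) ->
  fmap T (k o) \oc dl = fact_dlast Y \oc k l ->
  forall j, fmap T (k j) \oc loop d dl j = fmap T (k j) \oc w (Z j).
Proof.
move=> kE klE j; rewrite (loop_natural kE klE) loop_fact.
by have := nt_natural w (k j) => /= <-.
Qed.

End Transport.

Hypotheses (T_add : is_additive_functor T) (T_equiv : is_equivalence T).
Local Notation F := (Fact_cat n_gt1 w T_add).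

Section KernelsCokernels.

Lemma fact_kernel (X Y Z : factorization n_gt1 w) (k : fact_hom X Y) (g : fact_hom Y Z) :
  (forall j, is_kernel (k j) (g j)) -> @is_kernel F X Y Z k g.
Proof.
move=> hk; split=> [|W t gt]; first by apply: fact_hom_eq => j; apply: (hk j).1.
have gtj j : g j \oc t j = 0 by exact: (congr1 (fun f : fact_hom W Z => f j) gt).
pose s j := sval (cid ((hk j).2 _ _ (gtj j))).
have sE j : k j \oc s j = t j := (svalP (cid ((hk j).2 _ _ (gtj j)))).1.
have sd (i j : 'I_n) (e : j = i.+1 :> nat) : s j \oc fact_d W e = fact_d X e \oc s i.
  apply: (kernel_mono (hk j)).
  by rewrite compmA sE fact_morE compmA fact_morE -compmA sE.
have sl : fmap T (s o) \oc fact_dlast W = fact_dlast X \oc s l.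
  apply: (kernel_mono (fmap_kernel T_equiv T_add (hk o))).
  by rewrite compmA -fmapM sE fact_mor_lastE compmA fact_mor_lastE -compmA sE.
exists (FactHom sd sl); split; first by apply: fact_hom_eq => j; apply: sE.
move=> s' es'; apply: fact_hom_eq => j; apply: (kernel_mono (hk j)).
by rewrite sE -es'.
Qed.

Lemma fact_cokernel (X Y Z : factorization n_gt1 w) (f : fact_hom X Y) (c : fact_hom Y Z) :
  (forall j, is_cokernel (f j) (c j)) -> @is_cokernel F X Y Z f c.
Proof.
move=> hc; split=> [|W t tf]; first by apply: fact_hom_eq => j; apply: (hc j).1.
have tfj j : t j \oc f j = 0 by exact: (congr1 (fun f : fact_hom X W => f j) tf).
pose s j := sval (cid ((hc j).2 _ _ (tfj j))).
have sE j : s j \oc c j = t j := (svalP (cid ((hc j).2 _ _ (tfj j)))).1.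
have sd (i j : 'I_n) (e : j = i.+1 :> nat) : s j \oc fact_d Z e = fact_d W e \oc s i.
  apply: (cokernel_epi (hc i)).
  by rewrite -!compmA sE -fact_morE compmA sE fact_morE.
have sl : fmap T (s o) \oc fact_dlast Z = fact_dlast W \oc s l.
  apply: (cokernel_epi (hc l)).
  by rewrite -!compmA sE -fact_mor_lastE compmA -fmapM sE fact_mor_lastE.
exists (FactHom sd sl); split; first by apply: fact_hom_eq => j; apply: sE.
move=> s' es'; apply: fact_hom_eq => j; apply: (cokernel_epi (hc j)).
by rewrite sE -es'.
Qed.

End KernelsCokernels.

Variables (E : pair_class A) (hX : is_exact E).
Local Notation FE := (fact_exact (n_gt1 := n_gt1) (w := w) (T_add := T_add) E).

(** The cokernels of the components form a factorization. *)
Lemma fact_inflation (X Y : factorization n_gt1 w) (i : fact_hom X Y) :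
  (forall j, inflation E (i j)) -> @inflation F FE X Y i.
Proof.
move=> hi.
pose Z j := sval (cid (hi j)).
pose p j : hom (Y j) (Z j) := sval (cid (svalP (cid (hi j)))).
have hE j : E (i j) (p j) := svalP (cid (svalP (cid (hi j)))).
have hp j := exact_coker hX (hE j).
have dE' (a b : 'I_n) (e : b = a.+1 :> nat) : exists d, d \oc p a = p b \oc fact_d Y e.
  have [|d [ed _]] := (hp a).2 _ (p b \oc fact_d Y e); last by exists d.
  by rewrite -compmA -fact_morE compmA (hp b).1 comp0m.
have dlE : exists d, d \oc p l = fmap T (p o) \oc fact_dlast Y.
  have [|d [ed _]] := (hp l).2 _ (fmap T (p o) \oc fact_dlast Y); last by exists d.
  by rewrite -compmA -fact_mor_lastE compmA -fmapM (hp o).1 fmap_add0 // comp0m.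
pose d a b e := sval (cid (dE' a b e)).
have dE a b e : d a b e \oc p a = p b \oc fact_d Y e := svalP (cid (dE' a b e)).
have [dl {}dlE] := dlE.
have loopE j : loop d dl j = w (Z j).
  apply: (cokernel_epi (hp j)); apply: loop_out => [a b e|]; first by rewrite dE.
  by rewrite dlE.
pose ZF := fact_of_loop loopE.
have pd (a b : 'I_n) (e : b = a.+1 :> nat) : p b \oc fact_d Y e = fact_d ZF e \oc p a.
  by rewrite dE.
have pl : fmap T (p o) \oc fact_dlast Y = fact_dlast ZF \oc p l by rewrite dlE.
by exists ZF, (@FactHom _ _ _ _ _ Y ZF p pd pl) => j; apply: hE.
Qed.

(** The kernels of the components form a factorization; its last map exists
    because [T] preserves the kernel of the component at [0]. *)
Lemma fact_deflation (Y Z : factorization n_gt1 w) (p : fact_hom Y Z) :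
  (forall j, deflation E (p j)) -> @deflation F FE Y Z p.
Proof.
move=> hp.
pose X j := sval (cid (hp j)).
pose i j : hom (X j) (Y j) := sval (cid (svalP (cid (hp j)))).
have hE j : E (i j) (p j) := svalP (cid (svalP (cid (hp j)))).
have hi j := exact_ker hX (hE j).
have dE' (a b : 'I_n) (e : b = a.+1 :> nat) : exists d, i b \oc d = fact_d Y e \oc i a.
  have [|d [ed _]] := (hi b).2 _ (fact_d Y e \oc i a); last by exists d.
  by rewrite compmA fact_morE -compmA (hi a).1 compm0.
have Thi j := fmap_kernel T_equiv T_add (hi j).
have dlE : exists d, fmap T (i o) \oc d = fact_dlast Y \oc i l.
  have [|d [ed _]] := (Thi o).2 _ (fact_dlast Y \oc i l); last by exists d.
  by rewrite compmA fact_mor_lastE -compmA (hi l).1 compm0.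
pose d a b e := sval (cid (dE' a b e)).
have dE a b e : i b \oc d a b e = fact_d Y e \oc i a := svalP (cid (dE' a b e)).
have [dl {}dlE] := dlE.
have loopE j : loop d dl j = w (X j).
  by apply: (kernel_mono (Thi j)); apply: loop_in.
pose XF := fact_of_loop loopE.
have id (a b : 'I_n) (e : b = a.+1 :> nat) : i b \oc fact_d XF e = fact_d Y e \oc i a.
  by rewrite dE.
have il : fmap T (i o) \oc fact_dlast XF = fact_dlast Y \oc i l by rewrite dlE.
by exists XF, (@FactHom _ _ _ _ _ XF Y i id il) => j; apply: hE.
Qed.

(** The pushouts of the components form a factorization. *)
Lemma fact_pushout (X Y X' : factorization n_gt1 w) (i : fact_hom X Y) (f : fact_hom X X') :
  (forall j, inflation E (i j)) ->
  exists (Y' : factorization n_gt1 w) (f' : fact_hom Y Y') (i' : fact_hom X' Y'),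
    @is_pushout F X Y X' Y' i f f' i' /\ forall j, inflation E (i' j).
Proof.
move=> hi.
have hQ j : exists q : {Z : A & (hom (Y j) Z * hom (X' j) Z)%type},
    is_pushout (i j) (f j) (projT2 q).1 (projT2 q).2.
  have [Z [f' [i' [h _]]]] := exact_pushout hX (f j) (hi j).
  by exists (existT _ Z (f', i')).
pose Y' j := projT1 (sval (cid (hQ j))).
pose f' j : hom (Y j) (Y' j) := (projT2 (sval (cid (hQ j)))).1.
pose i' j : hom (X' j) (Y' j) := (projT2 (sval (cid (hQ j)))).2.
have po j : is_pushout (i j) (f j) (f' j) (i' j) := svalP (cid (hQ j)).
have sq j : f' j \oc i j = i' j \oc f j := (po j).1.
have dE' (a b : 'I_n) (e : b = a.+1 :> nat) : exists d,
    d \oc f' a = f' b \oc fact_d Y e /\ d \oc i' a = i' b \oc fact_d X' e.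
  have [|d [ed _]] := (po a).2 _ (f' b \oc fact_d Y e) (i' b \oc fact_d X' e); last by exists d.
  by rewrite -!compmA -!fact_morE !compmA sq.
have dlE : exists d, d \oc f' l = fmap T (f' o) \oc fact_dlast Y
    /\ d \oc i' l = fmap T (i' o) \oc fact_dlast X'.
  have [|d [ed _]] := (po l).2 _ (fmap T (f' o) \oc fact_dlast Y)
    (fmap T (i' o) \oc fact_dlast X'); last by exists d.
  by rewrite -!compmA -!fact_mor_lastE !compmA -!fmapM sq.
pose d a b e := sval (cid (dE' a b e)).
have dE a b e : d a b e \oc f' a = f' b \oc fact_d Y e
    /\ d a b e \oc i' a = i' b \oc fact_d X' e := svalP (cid (dE' a b e)).
have [dl [dlE1 dlE2]] := dlE.
have loopE j : loop d dl j = w (Y' j).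
  by apply: (pushout_epi (po j)); apply: loop_out => // a b e; rewrite ?(dE a b e).1 ?(dE a b e).2.
pose YF := fact_of_loop loopE.
have fd (a b : 'I_n) (e : b = a.+1 :> nat) : f' b \oc fact_d Y e = fact_d YF e \oc f' a.
  by rewrite (dE a b e).1.
have fl : fmap T (f' o) \oc fact_dlast Y = fact_dlast YF \oc f' l by rewrite dlE1.
have id (a b : 'I_n) (e : b = a.+1 :> nat) : i' b \oc fact_d X' e = fact_d YF e \oc i' a.
  by rewrite (dE a b e).2.
have il : fmap T (i' o) \oc fact_dlast X' = fact_dlast YF \oc i' l by rewrite dlE2.
pose f'F : fact_hom Y YF := @FactHom _ _ _ _ _ Y YF f' fd fl; pose i'F : fact_hom X' YF := @FactHom _ _ _ _ _ X' YF i' id il.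
exists YF, f'F, i'F; split; last by move=> j; apply: (inflation_of_pushout hX (po j)).
split=> [|W u v uv]; first by apply: fact_hom_eq.
have uvj j : u j \oc i j = v j \oc f j by exact: (congr1 (fun g : fact_hom X W => g j) uv).
pose s j := sval (cid ((po j).2 _ _ _ (uvj j))).
have sE j : s j \oc f' j = u j /\ s j \oc i' j = v j := (svalP (cid ((po j).2 _ _ _ (uvj j)))).1.
have sd (a b : 'I_n) (e : b = a.+1 :> nat) : s b \oc fact_d YF e = fact_d W e \oc s a.
  apply: (pushout_epi (po a)).
    by rewrite -!compmA (dE a b e).1 (sE a).1 compmA (sE b).1 fact_morE.
  by rewrite -!compmA (dE a b e).2 (sE a).2 compmA (sE b).2 fact_morE.
have sl : fmap T (s o) \oc fact_dlast YF = fact_dlast W \oc s l.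
  apply: (pushout_epi (po l)).
    by rewrite -!compmA dlE1 (sE l).1 compmA -fmapM (sE o).1 fact_mor_lastE.
  by rewrite -!compmA dlE2 (sE l).2 compmA -fmapM (sE o).2 fact_mor_lastE.
exists (@FactHom _ _ _ _ _ YF W s sd sl); split.
  by split; apply: fact_hom_eq => j; case: (sE j).
move=> s' [e1 e2]; apply: fact_hom_eq => j; apply: (pushout_epi (po j)).
  by rewrite (sE j).1 -e1.
by rewrite (sE j).2 -e2.
Qed.

(** As for kernels, the last map of the componentwise pullback needs that [T]
    preserves pullbacks. *)
Lemma fact_pullback (Y Z Z' : factorization n_gt1 w) (p : fact_hom Y Z) (f : fact_hom Z' Z) :
  (forall j, deflation E (p j)) ->
  exists (Y' : factorization n_gt1 w) (f' : fact_hom Y' Y) (p' : fact_hom Y' Z'),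
    @is_pullback F Y Z Y' Z' p f f' p' /\ forall j, deflation E (p' j).
Proof.
move=> hp.
have hQ j : exists q : {V : A & (hom V (Y j) * hom V (Z' j))%type},
    is_pullback (p j) (f j) (projT2 q).1 (projT2 q).2.
  have [V [f' [p' [h _]]]] := exact_pullback hX (f j) (hp j).
  by exists (existT _ V (f', p')).
pose Y' j := projT1 (sval (cid (hQ j))).
pose f' j : hom (Y' j) (Y j) := (projT2 (sval (cid (hQ j)))).1.
pose p' j : hom (Y' j) (Z' j) := (projT2 (sval (cid (hQ j)))).2.
have pb j : is_pullback (p j) (f j) (f' j) (p' j) := svalP (cid (hQ j)).
have Tpb j := fmap_pullback T_equiv (pb j).
have sq j : p j \oc f' j = f j \oc p' j := (pb j).1.
have dE' (a b : 'I_n) (e : b = a.+1 :> nat) : exists d,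
    f' b \oc d = fact_d Y e \oc f' a /\ p' b \oc d = fact_d Z' e \oc p' a.
  have [|d [ed _]] := (pb b).2 _ (fact_d Y e \oc f' a) (fact_d Z' e \oc p' a); last by exists d.
  by rewrite !compmA !fact_morE -!compmA sq.
have dlE : exists d, fmap T (f' o) \oc d = fact_dlast Y \oc f' l
    /\ fmap T (p' o) \oc d = fact_dlast Z' \oc p' l.
  have [|d [ed _]] := (Tpb o).2 _ (fact_dlast Y \oc f' l) (fact_dlast Z' \oc p' l); last by exists d.
  by rewrite !compmA !fact_mor_lastE -!compmA sq.
pose d a b e := sval (cid (dE' a b e)).
have dE a b e : f' b \oc d a b e = fact_d Y e \oc f' a
    /\ p' b \oc d a b e = fact_d Z' e \oc p' a := svalP (cid (dE' a b e)).
have [dl [dlE1 dlE2]] := dlE.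
have loopE j : loop d dl j = w (Y' j).
  by apply: (pullback_mono (Tpb j)); apply: loop_in => // a b e; case: (dE a b e).
pose YF := fact_of_loop loopE.
have fd (a b : 'I_n) (e : b = a.+1 :> nat) : f' b \oc fact_d YF e = fact_d Y e \oc f' a.
  by case: (dE a b e).
have pd (a b : 'I_n) (e : b = a.+1 :> nat) : p' b \oc fact_d YF e = fact_d Z' e \oc p' a.
  by case: (dE a b e).
pose f'F : fact_hom YF Y := @FactHom _ _ _ _ _ YF Y f' fd dlE1; pose p'F : fact_hom YF Z' := @FactHom _ _ _ _ _ YF Z' p' pd dlE2.
exists YF, f'F, p'F; split; last by move=> j; apply: (deflation_of_pullback hX (pb j)).
split=> [|W u v uv]; first by apply: fact_hom_eq.
have uvj j : p j \oc u j = f j \oc v j by exact: (congr1 (fun g : fact_hom W Z => g j) uv).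
pose s j := sval (cid ((pb j).2 _ _ _ (uvj j))).
have sE j : f' j \oc s j = u j /\ p' j \oc s j = v j := (svalP (cid ((pb j).2 _ _ _ (uvj j)))).1.
have sd (a b : 'I_n) (e : b = a.+1 :> nat) : s b \oc fact_d W e = fact_d YF e \oc s a.
  apply: (pullback_mono (pb b)).
    by rewrite !compmA fd (sE b).1 -compmA (sE a).1 fact_morE.
  by rewrite !compmA pd (sE b).2 -compmA (sE a).2 fact_morE.
have sl : fmap T (s o) \oc fact_dlast W = fact_dlast YF \oc s l.
  apply: (pullback_mono (Tpb o)).
    by rewrite !compmA dlE1 -fmapM (sE o).1 -compmA (sE l).1 fact_mor_lastE.
  by rewrite !compmA dlE2 -fmapM (sE o).2 -compmA (sE l).2 fact_mor_lastE.
exists (@FactHom _ _ _ _ _ W YF s sd sl); split.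
  by split; apply: fact_hom_eq => j; case: (sE j).
move=> s' [e1 e2]; apply: fact_hom_eq => j; apply: (pullback_mono (pb j)).
  by rewrite (sE j).1 -e1.
by rewrite (sE j).2 -e2.
Qed.

Lemma fact_zero_object : exists Z : F, is_zero_object Z.
Proof.
have [[O [hO1 hO2]] _] := exact_additive hX.
pose d (i j : 'I_n) (e : j = i.+1 :> nat) : hom O O := 0.
have loopE (j : 'I_n) : @loop (fun=> O) d 0 j = w O by apply: hO2.
exists (fact_of_loop loopE); split=> X f g; apply: fact_hom_eq => j; [exact: hO1|exact: hO2].
Qed.

Lemma fact_biproduct (X Y : F) : exists (S : F) (i1 : hom X S) (i2 : hom Y S)
  (p1 : hom S X) (p2 : hom S Y), is_biproduct i1 i2 p1 p2.
Proof.
have hQ (j : 'I_n) : exists q : {S : A & ((hom (X j) S * hom (Y j) S) * (hom S (X j) * hom S (Y j)))%type},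
    is_biproduct (projT2 q).1.1 (projT2 q).1.2 (projT2 q).2.1 (projT2 q).2.2.
  have [S [i1 [i2 [p1 [p2 h]]]]] := (exact_additive hX).2 (X j) (Y j).
  by exists (existT _ S ((i1, i2), (p1, p2))).
pose S j := projT1 (sval (cid (hQ j))).
pose i1 j : hom (X j) (S j) := (projT2 (sval (cid (hQ j)))).1.1.
pose i2 j : hom (Y j) (S j) := (projT2 (sval (cid (hQ j)))).1.2.
pose p1 j : hom (S j) (X j) := (projT2 (sval (cid (hQ j)))).2.1.
pose p2 j : hom (S j) (Y j) := (projT2 (sval (cid (hQ j)))).2.2.
have hb j : is_biproduct (i1 j) (i2 j) (p1 j) (p2 j) := svalP (cid (hQ j)).
pose d (a b : 'I_n) (e : b = a.+1 :> nat) : hom (S a) (S b) :=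
  i1 b \oc fact_d X e \oc p1 a + i2 b \oc fact_d Y e \oc p2 a.
pose dl : hom (S l) (T (S o)) :=
  fmap T (i1 o) \oc fact_dlast X \oc p1 l + fmap T (i2 o) \oc fact_dlast Y \oc p2 l.
have Tb j : is_biproduct (fmap T (i1 j)) (fmap T (i2 j)) (fmap T (p1 j)) (fmap T (p2 j)).
  have [e1 e2 e3 e4 e5] := hb j.
  by split; rewrite -!fmapM -?T_add ?(e1, e2, e3, e4, e5) ?fmap1 ?fmap_add0.
have i1d (a b : 'I_n) (e : b = a.+1 :> nat) : i1 b \oc fact_d X e = d a b e \oc i1 a.
  by rewrite compmDl -!compmA !(biproductE (hb a)) !compm_unit.
have i2d (a b : 'I_n) (e : b = a.+1 :> nat) : i2 b \oc fact_d Y e = d a b e \oc i2 a.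
  by rewrite compmDl -!compmA !(biproductE (hb a)) !compm_unit.
have p1d (a b : 'I_n) (e : b = a.+1 :> nat) : p1 b \oc d a b e = fact_d X e \oc p1 a.
  by rewrite compmDr -!compmA !(biproductE (hb b)) !compm_unit.
have p2d (a b : 'I_n) (e : b = a.+1 :> nat) : p2 b \oc d a b e = fact_d Y e \oc p2 a.
  by rewrite compmDr -!compmA !(biproductE (hb b)) !compm_unit.
have i1l : fmap T (i1 o) \oc fact_dlast X = dl \oc i1 l.
  by rewrite compmDl -!compmA !(biproductE (hb l)) !compm_unit.
have i2l : fmap T (i2 o) \oc fact_dlast Y = dl \oc i2 l.
  by rewrite compmDl -!compmA !(biproductE (hb l)) !compm_unit.
have p1l : fmap T (p1 o) \oc dl = fact_dlast X \oc p1 l.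
  by rewrite compmDr -!compmA !(biproductE (Tb o)) !compm_unit.
have p2l : fmap T (p2 o) \oc dl = fact_dlast Y \oc p2 l.
  by rewrite compmDr -!compmA !(biproductE (Tb o)) !compm_unit.
have loopE j : loop d dl j = w (S j).
  rewrite -[loop d dl j](biproduct_sum (hb j)) -[w (S j)](biproduct_sum (hb j)) !compmA.
  by rewrite (loop_out i1d i1l) (loop_out i2d i2l).
pose SF := fact_of_loop loopE.
exists SF, (@FactHom _ _ _ _ _ X SF i1 i1d i1l), (@FactHom _ _ _ _ _ Y SF i2 i2d i2l),
  (@FactHom _ _ _ _ _ SF X p1 p1d p1l), (@FactHom _ _ _ _ _ SF Y p2 p2d p2l).
by split; apply: fact_hom_eq => j; case: (hb j).
Qed.

Lemma fact_iso (X Y : F) (f : fact_hom X Y) (j : 'I_n) : @is_iso F X Y f -> is_iso (f j).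
Proof.
move=> [g [e1 e2]]; exists ((g : fact_hom Y X) j).
by split; [apply: (congr1 (fun h : fact_hom X X => h j) e1)
          |apply: (congr1 (fun h : fact_hom Y Y => h j) e2)].
Qed.

Lemma fact_biproduct_at (X Y S : F) (i1 : fact_hom X S) (i2 : fact_hom Y S)
    (p1 : fact_hom S X) (p2 : fact_hom S Y) (j : 'I_n) :
  @is_biproduct F X Y S i1 i2 p1 p2 -> is_biproduct (i1 j) (i2 j) (p1 j) (p2 j).
Proof.
case=> e1 e2 e3 e4 e5; split.
- exact: (congr1 (fun h : fact_hom X X => h j) e1).
- exact: (congr1 (fun h : fact_hom Y Y => h j) e2).
- exact: (congr1 (fun h : fact_hom Y X => h j) e3).
- exact: (congr1 (fun h : fact_hom X Y => h j) e4).
- exact: (congr1 (fun h : fact_hom S S => h j) e5).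
Qed.

Lemma inflation_fact (X Y : F) (i : fact_hom X Y) (j : 'I_n) :
  @inflation F FE X Y i -> inflation E (i j).
Proof. by move=> [Z [p h]]; exists (Z j), ((p : fact_hom Y Z) j). Qed.

Lemma deflation_fact (Y Z : F) (p : fact_hom Y Z) (j : 'I_n) :
  @deflation F FE Y Z p -> deflation E (p j).
Proof. by move=> [X [i h]]; exists (X j), ((i : fact_hom X Y) j). Qed.

Lemma fact_is_exact : is_exact FE.
Proof.
split.
- split; [exact: fact_zero_object|exact: fact_biproduct].
- by move=> X Y Z i p h; apply: fact_kernel => j; apply: exact_ker hX _ _ _ _ _ (h j).
- by move=> X Y Z i p h; apply: fact_cokernel => j; apply: exact_coker hX _ _ _ _ _ (h j).
- move=> X Y Z X' Y' Z' i p i' p' a b c ia ib ic e1 e2 h j.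
  apply: (exact_iso hX (fact_iso j ia) (fact_iso j ib) (fact_iso j ic) _ _ (h j)).
    exact: (congr1 (fun h : fact_hom X Y' => h j) e1).
  exact: (congr1 (fun h : fact_hom Y Z' => h j) e2).
- by move=> X; apply: fact_inflation => j; apply: exact_infl1.
- by move=> X; apply: fact_deflation => j; apply: exact_defl1.
- move=> X Y Z j i hi hj; apply: fact_inflation => k.
  by apply: (exact_inflM hX); apply: inflation_fact.
- move=> X Y Z j i hi hj; apply: fact_deflation => k.
  by apply: (exact_deflM hX); apply: deflation_fact.
- move=> X Y X' i f hi.
  have [|Y' [f' [i' [po h]]]] := @fact_pushout X Y X' i f; first by move=> j; apply: inflation_fact.
  by exists Y', f', i'; split=> //; apply: fact_inflation.
- move=> Y Z Z' p f hp.
  have [|Y' [f' [p' [pb h]]]] := @fact_pullback Y Z Z' p f; first by move=> j; apply: deflation_fact.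
  by exists Y', f', p'; split=> //; apply: fact_deflation.
Qed.

End Factorizations.

(** * Adjoints of the evaluation functors *)

Section Coinduced.
Variables (n : nat) (n_gt1 : (1 < n)%N) (A : preadditive) (T : functor A A).
Variables (w : nat_trans (id_functor A) T) (wT : forall X : A, w (T X) = fmap T (w X)).

Local Notation o := (ord_first n_gt1).
Local Notation l := (ord_last n_gt1).

Variables (k : 'I_n) (I : A).

Definition step_ob (b : bool) : A := if b then I else T I.

(** The transition from an entry [step_ob b] to a later one [step_ob c], where
    the boolean tells whether the index is at most [k]. It cannot change from
    [false] to [true], where the value [0] is a default. *)
Definition step_d (b c : bool) : hom (step_ob b) (step_ob c) :=
  match b, c return hom (step_ob b) (step_ob c) with
  | true, true => idm I
  | true, false => w I
  | false, false => idm (T I)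
  | false, true => 0
  end.

Definition step_last (b : bool) : hom (step_ob b) (T I) :=
  if b return hom (step_ob b) (T I) then w I else idm (T I).

Lemma step_dM (a b c : bool) : (b -> a) -> (c -> b) ->
  step_d b c \oc step_d a b = step_d a c.
Proof.
case: a b c => [] [] [] //= ha hb; rewrite ?comp1m ?compm1 //.
all: by [have := ha isT | have := hb isT].
Qed.

Lemma step_d_id (b : bool) : step_d b b = idm (step_ob b).
Proof. by case: b. Qed.

Lemma step_d_iso (b c : bool) : b = c -> is_iso (step_d b c).
Proof. by move->; rewrite step_d_id; apply: is_iso_id. Qed.

Lemma step_loop (b c : bool) : (c -> b) ->
  fmap T (step_d true b) \oc step_last c \oc step_d b c = w (step_ob b).
Proof.
case: b c => [] [] //= h; rewrite ?fmap1 ?comp1m ?compm1 ?wT //.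
by have := h isT.
Qed.

Definition coind_d (i j : 'I_n) (_ : j = i.+1 :> nat) :
  hom (step_ob (i <= k)%N) (step_ob (j <= k)%N) := step_d (i <= k)%N (j <= k)%N.

Lemma coind_d_path (i j : 'I_n) :
  (i <= j)%N -> path_map coind_d i j = step_d (i <= k)%N (j <= k)%N.
Proof.
move: j; apply: (path_map_ind (Q := fun j x => x = step_d (i <= k)%N (j <= k)%N)).
  by rewrite step_d_id.
move=> a b e _ h ->; apply: step_dM; first exact: leq_trans.
by rewrite e; apply: ltnW.
Qed.

Lemma coind_loop (j : 'I_n) :
  loop (n_gt1 := n_gt1) coind_d (step_last (l <= k)%N) j = w (step_ob (j <= k)%N).
Proof.
rewrite /loop (coind_d_path (ord_first_le n_gt1 j)) (coind_d_path (le_ord_last n_gt1 j)).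
by apply: step_loop; apply: leq_trans; apply: le_ord_last.
Qed.

(** The sequence with entries [I] up to the index [k] and [T I] after it, whose
    only map that is not an identity is an instance of [w]. It is the value at
    [I] of the right adjoint of [X |-> X k], and at the same time the value at
    [T I] of the left adjoint of [X |-> X (k + 1)], or at [I] of the left
    adjoint of [X |-> X 0] if [k] is the last index. *)
Definition coind : factorization n_gt1 w := fact_of_loop coind_loop.

Lemma coind_path (i j : 'I_n) :
  (i <= j)%N -> path_map (fact_d coind) i j = step_d (i <= k)%N (j <= k)%N.
Proof. exact: coind_d_path. Qed.

Section Into.
Variables (X : factorization n_gt1 w).
Local Notation pm := (path_map (fact_d X)).

(** The maps of [coind] up to [k] are identities, which determines the
    components up to [k]; the component at [0] determines the last one, and this
    one the components beyond [k]. *)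
Lemma coind_into_eq (s t : fact_hom X coind) : s k = t k -> s = t.
Proof.
move=> e.
have low (j : 'I_n) : (j <= k)%N -> s j = t j.
  move=> jk; apply: (iso_cancel_l (a := step_d (j <= k)%N (k <= k)%N)).
    by apply: step_d_iso; rewrite jk leqnn.
  have := fact_path_natural s jk; have := fact_path_natural t jk.
  by rewrite e coind_path // => -> ->.
apply: fact_hom_eq => j; case: (leqP j k) => [|kj]; first exact: low.
have kl : (l <= k)%N = false by apply/negbTE; rewrite -ltnNge (leq_trans kj) // le_ord_last.
have last : s l = t l.
  have inj' (V : A) (b : bool) (x y : hom V (step_ob b)) :
      b = false -> step_last b \oc x = step_last b \oc y -> x = y.
    by case: b x y => //= x y _; rewrite !comp1m.
  apply: (inj' _ _ _ _ kl).
  have := fact_mor_lastE s; have := fact_mor_lastE t; rewrite (low o) //= => -> ->.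
  by [].
apply: (iso_cancel_l (a := step_d (j <= k)%N (l <= k)%N)).
  by apply: step_d_iso; rewrite kl; apply/negbTE; rewrite -ltnNge.
have := fact_path_natural s (le_ord_last n_gt1 j).
have := fact_path_natural t (le_ord_last n_gt1 j).
by rewrite last coind_path ?le_ord_last // => -> ->.
Qed.

Variable g : hom (X k) I.

Definition into_mor (b : bool) (j : 'I_n) : hom (X j) (step_ob b) :=
  if b return hom (X j) (step_ob b) then g \oc pm j k
  else fmap T (g \oc pm o k) \oc fact_dlast X \oc pm j l.

Lemma into_mor_d (b c : bool) (i j : 'I_n) (e : j = i.+1 :> nat) :
  b = (i <= k)%N -> c = (j <= k)%N -> into_mor c j \oc fact_d X e = step_d b c \oc into_mor b i.
Proof.
case: b c => [] [] /=; rewrite ?comp1m => hb hc.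
- by rewrite -compmA -path_map_cons.
- have {hb hc} ik : i = k.
    by apply: ord_inj; apply/eqP; rewrite eqn_leq -hb -ltnS -e ltnNge -hc.
  subst i; rewrite -compmA -(path_map_cons _ e) ?le_ord_last // path_map_id compm1.
  rewrite fmapM -!compmA.
  have := loop_fact X k; rewrite /loop -!compmA => ->.
  by have := nt_natural w g.
- by move: (esym hc); rewrite e => /ltnW; rewrite -hb.
- by rewrite -compmA -(path_map_cons _ e) ?le_ord_last.
Qed.

Lemma into_mor_last (b : bool) : b = (l <= k)%N ->
  fmap T (into_mor true o) \oc fact_dlast X = step_last b \oc into_mor b l.
Proof.
case: b => /= h; last by rewrite comp1m path_map_id compm1.
have kl : k = l by apply: ord_inj; apply/eqP; rewrite eqn_leq -h le_ord_last.
have key (m : 'I_n) (f : hom (X m) I) : m = l ->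
    fmap T (f \oc pm o m) \oc fact_dlast X = w I \oc (f \oc pm l m).
  move=> em; subst m; rewrite path_map_id compm1.
  have := nt_natural w f; rewrite /= => ->; rewrite -loop_fact /loop path_map_id compm1.
  by rewrite compmA fmapM.
by rewrite key // path_map_id compm1.
Qed.

Definition coind_into : fact_hom X coind :=
  @FactHom _ _ _ _ _ X coind (fun j => into_mor (j <= k)%N j)
    (fun i j e => into_mor_d e erefl erefl) (into_mor_last erefl).

Lemma coind_intoE : step_d (k <= k)%N true \oc coind_into k = g.
Proof.
have h (b : bool) : b = true -> step_d b true \oc into_mor b k = g.
  by move->; rewrite /= path_map_id comp1m compm1.
exact: h (leqnn k).
Qed.

End Into.

Section OutOf.
Variables (X : factorization n_gt1 w).
Local Notation pm := (path_map (fact_d X)).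

Lemma coind_out_eq (s t : fact_hom coind X) :
  s o = t o -> (forall j : 'I_n, (k < j)%N -> s j = t j) -> s = t.
Proof.
move=> e0 e; apply: fact_hom_eq => j; case: (leqP j k) => [jk|]; last exact: e.
apply: (iso_cancel_r (a := step_d (o <= k)%N (j <= k)%N)).
  by apply: step_d_iso; rewrite jk.
have := fact_path_natural s (ord_first_le n_gt1 j).
have := fact_path_natural t (ord_first_le n_gt1 j).
by rewrite e0 coind_path // => -> ->.
Qed.

(** A morphism out of [coind] is given by its component [f0] at [0] and by its
    components [f] beyond [k], subject to three commutations. *)
Variables (f0 : hom I (X o)) (f : forall j, hom (T I) (X j)).
Hypotheses
  (fd : forall (i j : 'I_n) (e : j = i.+1 :> nat), (k < i)%N -> fact_d X e \oc f i = f j)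
  (fk : forall j : 'I_n, j = k.+1 :> nat -> f j \oc w I = pm o j \oc f0)
  (fl : (k < l)%N -> fact_dlast X \oc f l = fmap T f0).

Definition out_mor (b : bool) (j : 'I_n) : hom (step_ob b) (X j) :=
  if b return hom (step_ob b) (X j) then pm o j \oc f0 else f j.

Lemma out_mor_d (b c : bool) (i j : 'I_n) (e : j = i.+1 :> nat) :
  b = (i <= k)%N -> c = (j <= k)%N -> out_mor c j \oc step_d b c = fact_d X e \oc out_mor b i.
Proof.
case: b c => [] [] /=; rewrite ?compm1 => hb hc.
- by rewrite (path_mapS _ e) // compmA.
- have ik : i = k.
    by apply: ord_inj; apply/eqP; rewrite eqn_leq -hb -ltnS -e ltnNge -hc.
  by rewrite fk ?(path_mapS _ e) ?compmA // e ik.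
- by move: (esym hc); rewrite e => /ltnW; rewrite -hb.
- by rewrite fd // ltnNge -hb.
Qed.

Lemma out_mor_last (b : bool) : b = (l <= k)%N ->
  fmap T (out_mor true o) \oc step_last b = fact_dlast X \oc out_mor b l.
Proof.
rewrite /= path_map_id comp1m; case: b => /= h; last by rewrite compm1 fl // ltnNge -h.
have := nt_natural w f0; rewrite /= => <-.
by rewrite -loop_fact /loop path_map_id fmap1 comp1m compmA.
Qed.

Definition coind_out : fact_hom coind X :=
  @FactHom _ _ _ _ _ coind X (fun j => out_mor (j <= k)%N j)
    (fun i j e => out_mor_d e erefl erefl) (out_mor_last erefl).

End OutOf.

Section OutOfNext.
Variables (X : factorization n_gt1 w) (j1 : 'I_n) (e1 : j1 = k.+1 :> nat).
Variables (T_faithful : faithful T) (T_full : full T).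
Local Notation pm := (path_map (fact_d X)).

(** The component at [0] of a morphism out of [coind] is recovered from [g]
    since the last map of [coind] is the identity of [T I]. *)
Lemma coind_out_next (g : hom (T I) (X j1)) :
  exists s : fact_hom coind X, s j1 \oc step_d false (j1 <= k)%N = g.
Proof.
have [f0 ef0] := T_full (fact_dlast X \oc pm j1 l \oc g).
have h1 (i j : 'I_n) (e : j = i.+1 :> nat) : (k < i)%N ->
    fact_d X e \oc (pm j1 i \oc g) = pm j1 j \oc g.
  by move=> ki; rewrite (path_mapS _ e) ?compmA // e1.
have h2 (j : 'I_n) : j = k.+1 :> nat -> (pm j1 j \oc g) \oc w I = pm o j \oc f0.
  move=> ej; have -> : j = j1 by apply: ord_inj; rewrite ej e1.
  rewrite path_map_id comp1m; apply: T_faithful.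
  rewrite !fmapM ef0 -wT -(nt_natural w g) /= -loop_fact /loop.
  by rewrite -!compmA.
have h3 : (k < l)%N -> fact_dlast X \oc (pm j1 l \oc g) = fmap T f0.
  by rewrite ef0 compmA.
exists (coind_out h1 h2 h3).
have h (b : bool) : b = false ->
    out_mor (X := X) f0 (fun j => pm j1 j \oc g) b j1 \oc step_d false b = g.
  by move->; rewrite /= path_map_id comp1m compm1.
by apply: h; apply/negbTE; rewrite -ltnNge e1.
Qed.

(** The component at [k + 1] determines the later ones; the last one determines
    the component at [0], and this one the components up to [k]. *)
Lemma coind_out_next_eq (s t : fact_hom coind X) : s j1 = t j1 -> s = t.
Proof.
move=> e.
have high (j : 'I_n) : (k < j)%N -> s j = t j.
  move=> kj; have j1j : (j1 <= j)%N by rewrite e1.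
  apply: (iso_cancel_r (a := step_d (j1 <= k)%N (j <= k)%N)).
    by apply: step_d_iso; rewrite [in LHS]leqNgt e1 ltnSn leqNgt kj.
  have := fact_path_natural s j1j; have := fact_path_natural t j1j.
  by rewrite e coind_path // => -> ->.
apply: (coind_out_eq _ high).
have kl : (k < l)%N by apply: leq_trans (le_ord_last n_gt1 j1); rewrite e1.
apply: T_faithful; apply: (iso_cancel_r (a := step_last (l <= k)%N)).
  by rewrite leqNgt kl; apply: is_iso_id.
have := fact_mor_lastE s; have := fact_mor_lastE t.
by rewrite (high l kl) => /= -> ->.
Qed.

End OutOfNext.

Section OutOfFirst.
Variables (X : factorization n_gt1 w) (kl : (l <= k)%N).

Lemma coind_out_first (g : hom I (X o)) :
  exists s : fact_hom coind X, s o \oc step_d true (o <= k)%N = g.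
Proof.
have h1 (i j : 'I_n) (e : j = i.+1 :> nat) : (k < i)%N -> fact_d X e \oc 0 = 0 :> hom (T I) (X j).
  by rewrite ltnNge (leq_trans (le_ord_last n_gt1 i) kl).
have h2 (j : 'I_n) : j = k.+1 :> nat -> 0 \oc w I = path_map (fact_d X) o j \oc g.
  by move=> ej; have := leq_trans (le_ord_last n_gt1 j) kl; rewrite ej ltnn.
have h3 : (k < l)%N -> fact_dlast X \oc 0 = fmap T g by rewrite ltnNge kl.
by exists (coind_out h1 h2 h3); rewrite /= path_map_id comp1m compm1.
Qed.

Lemma coind_out_first_eq (s t : fact_hom coind X) : s o = t o -> s = t.
Proof.
move=> e; apply: coind_out_eq => // j.
by rewrite ltnNge (leq_trans (le_ord_last n_gt1 j) kl).
Qed.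

End OutOfFirst.

End Coinduced.

(** * The Frobenius property *)

Section EquivalenceProjectives.
Variables (A : preadditive) (E : pair_class A) (hX : is_exact E).
Variables (T : functor A A) (T_equiv : is_equivalence T).
Hypothesis hT : preserves_reflects_conflations E T.

Let T_faithful := equivalence_faithful T_equiv.
Let T_full := equivalence_full T_equiv.
Let T_es := equivalence_ess_surjective T_equiv.

Lemma projective_iso (P Q : A) (a : hom P Q) :
  is_iso a -> projective E P -> projective E Q.
Proof.
move=> [b [_ ab]] hP Y Z p hp f; have [g eg] := hP _ _ p hp (f \oc a).
by exists (g \oc b); rewrite compmA eg -compmA ab compm1.
Qed.

Lemma projective_reflect (P : A) : projective E (T P) -> projective E P.
Proof.
move=> hP Y Z p [X [i hi]] f.
have [|g eg] := hP _ _ (fmap T p) _ (fmap T f).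
  by exists (T X), (fmap T i); apply: (@hT X Y Z i p).1.
have [g' eg'] := T_full g; exists g'.
by apply: T_faithful; rewrite fmapM eg'.
Qed.

(** The problem is transported along the equivalence: a deflation is isomorphic
    to the image under [T] of a morphism, which is a deflation since [T] reflects
    conflations. *)
Lemma projective_preserve (P : A) : projective E P -> projective E (T P).
Proof.
move=> hP Y Z p [X [i hi]] f.
have [Y' [y iy]] := T_es Y; have [Z' [z iz]] := T_es Z; have [X' [x ix]] := T_es X.
have [y' [y'y yy']] := iy; have [z' [z'z zz']] := iz.
have [p' ep] := T_full (z' \oc p \oc y); have [i' ei] := T_full (y' \oc i \oc x).
have hp' : deflation E p'.
  exists X', i'; apply: (@hT X' Y' Z' i' p').2; have [x' [x'x xx']] := ix.
  have jx : is_iso x' by exists x.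
  have jy : is_iso y' by exists y.
  have jz : is_iso z' by exists z.
  apply: (exact_iso hX jx jy jz _ _ hi).
    by rewrite ei -compmA xx' compm1.
  by rewrite ep -!compmA yy' compm1.
have [f' ef] := T_full (z' \oc f); have [g' eg] := hP _ _ _ hp' f'.
exists (y \oc fmap T g'); apply: (iso_cancel_l (a := z')); first by exists z.
by rewrite -ef -eg fmapM ep -!compmA.
Qed.

Lemma projective_cover_image (X : A) : is_frobenius E ->
  exists P (p : hom (T P) X), projective E P /\ deflation E p.
Proof.
move=> hF; have [Q [q [hQ hq]]] := enough_projectives hF X.
have [P [e ie]] := T_es Q; exists P, (q \oc e); split; last exact: deflation_iso_r.
apply: projective_reflect; have [e' [e'e ee']] := ie.
by apply: (projective_iso (a := e')) hQ; exists e.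
Qed.

End EquivalenceProjectives.

Section Injectives.
Variables (A : preadditive) (E : pair_class A).

Lemma biproduct_injective (I J S : A) (i1 : hom I S) (i2 : hom J S)
    (p1 : hom S I) (p2 : hom S J) :
  is_biproduct i1 i2 p1 p2 -> injective_ob E I -> injective_ob E J -> injective_ob E S.
Proof.
move=> hb hI hJ X Y i hi f.
have [g1 e1] := hI _ _ i hi (p1 \oc f); have [g2 e2] := hJ _ _ i hi (p2 \oc f).
exists (i1 \oc g1 + i2 \oc g2).
by rewrite compmDl -!compmA e1 e2 (biproduct_sum hb).
Qed.

Lemma zero_injective (Z : A) : is_zero_object Z -> injective_ob E Z.
Proof. by move=> [Z0 _] X Y i _ f; exists 0; apply: Z0. Qed.

Lemma retract_projective (P Q : A) (s : hom P Q) (r : hom Q P) :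
  r \oc s = idm P -> projective E Q -> projective E P.
Proof.
move=> rs hQ Y Z p hp f; have [g eg] := hQ _ _ p hp (f \oc r).
by exists (g \oc s); rewrite compmA eg -compmA rs compm1.
Qed.

Lemma retract_injective (P Q : A) (s : hom P Q) (r : hom Q P) :
  r \oc s = idm P -> injective_ob E Q -> injective_ob E P.
Proof.
move=> rs hQ Y Z i hi f; have [g eg] := hQ _ _ i hi (s \oc f).
by exists (r \oc g); rewrite -compmA eg compmA rs comp1m.
Qed.

(** A projective object is a retract of the source of a deflation onto it. *)
Lemma frobenius_of_projective_injective : is_exact E ->
  (forall X, exists P (p : hom P X), [/\ projective E P, injective_ob E P & deflation E p]) ->
  (forall X, exists I (i : hom X I), [/\ projective E I, injective_ob E I & inflation E i]) ->
  is_frobenius E.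
Proof.
move=> hX hP hI; split=> // [X|X|P].
- by have [P [p [? _ ?]]] := hP X; exists P, p.
- by have [I [i [_ ? ?]]] := hI X; exists I, i.
split=> [h|h].
  have [Q [p [_ hQ hp]]] := hP P; have [s es] := h _ _ p hp (idm P).
  exact: retract_injective es hQ.
have [Q [i [hQ _ hi]]] := hI P; have [r er] := h _ _ i hi (idm P).
exact: retract_projective er hQ.
Qed.

End Injectives.

Section Frobenius.
Variables (n : nat) (n_gt1 : (1 < n)%N) (A : preadditive) (E : pair_class A).
Variables (hE : is_frobenius E) (T : functor A A) (T_add : is_additive_functor T).
Variables (T_equiv : is_equivalence T) (w : nat_trans (id_functor A) T).
Hypothesis wT : forall X : A, w (T X) = fmap T (w X).
Hypothesis hT : preserves_reflects_conflations E T.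

Local Notation F := (Fact_cat n_gt1 w T_add).
Local Notation FE := (fact_exact (n_gt1 := n_gt1) (w := w) (T_add := T_add) E).
Local Notation o := (ord_first n_gt1).
Local Notation l := (ord_last n_gt1).
Let hX := frobenius_exact hE.
Let hFX := fact_is_exact n_gt1 w T_add T_equiv hX.

Lemma coind_injective (k : 'I_n) (I : A) : injective_ob E I ->
  @injective_ob F FE (coind n_gt1 wT k I).
Proof.
move=> hI X Y i hi f.
have [g eg] := hI _ _ _ (inflation_fact k hi)
  (step_d w I (k <= k)%N true \oc (f : fact_hom X (coind n_gt1 wT k I)) k).
exists (coind_into wT g); apply: coind_into_eq.
apply: (iso_cancel_l (a := step_d w I (k <= k)%N true)).
  by apply: step_d_iso; rewrite leqnn.
by rewrite -eg /= compmA; congr (_ \oc _); apply: coind_intoE.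
Qed.

(** A lifting problem out of [coind] is a lifting problem for [P] at the
    component [0] when [k] is the last index, and for [T P] at [k + 1]
    otherwise. *)
Lemma coind_projective (k : 'I_n) (P : A) : projective E P ->
  @projective F FE (coind n_gt1 wT k P).
Proof.
move=> hP Y Z p hp f; have [lk|kl] := leqP l k.
  have [g eg] := hP _ _ _ (deflation_fact o hp)
    ((f : fact_hom (coind n_gt1 wT k P) Z) o \oc step_d w P true (o <= k)%N).
  have [s es] := coind_out_first wT lk g.
  exists s; apply: (coind_out_first_eq lk).
  apply: (iso_cancel_r (a := step_d w P true (o <= k)%N)); first exact: step_d_iso.
  by rewrite -eg -es compmA.
have kn : (k.+1 < n)%N by apply: leq_ltn_trans (ltn_ord l).
pose j1 := Ordinal kn.
have [g eg] := projective_preserve hX T_equiv hT hP (deflation_fact j1 hp)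
  ((f : fact_hom (coind n_gt1 wT k P) Z) j1 \oc step_d w P false (j1 <= k)%N).
have [s es] := coind_out_next wT (j1 := j1) erefl (equivalence_faithful T_equiv)
  (equivalence_full T_equiv) g.
exists s; apply: (coind_out_next_eq (j1 := j1) erefl (equivalence_faithful T_equiv)).
apply: (iso_cancel_r (a := step_d w P false (j1 <= k)%N)).
  by apply: step_d_iso; rewrite ltnn.
by rewrite -eg -es compmA.
Qed.

Lemma fact_cover_at (X : F) (j : 'I_n) : exists (P : F) (p : fact_hom P X),
  [/\ @projective F FE P, @injective_ob F FE P & deflation E (p j)].
Proof.
have proj_inj := projective_injective hE.
case: (posnP j) => [j0|j0].
  have -> : j = o by apply: ord_inj.
  have [P [g [hP hg]]] := enough_projectives hE ((X : factorization n_gt1 w) o).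
  have [s es] := coind_out_first wT (leqnn l) g.
  exists (coind n_gt1 wT l P), s; split.
  - exact: coind_projective.
  - exact/coind_injective/proj_inj.
  - by rewrite -[s o]compm1 -(step_d_id w P true) es.
have kn : (j.-1 < n)%N by apply: leq_ltn_trans (leq_pred j) (ltn_ord j).
pose k := Ordinal kn; have jk : j = k.+1 :> nat by rewrite /= prednK.
have [P [g [hP hg]]] := projective_cover_image hX T_equiv hT ((X : factorization n_gt1 w) j) hE.
have [s es] := coind_out_next wT jk (equivalence_faithful T_equiv) (equivalence_full T_equiv) g.
exists (coind n_gt1 wT k P), s; split.
- exact: coind_projective.
- exact/coind_injective/proj_inj.
have [|b [ba ab]] := step_d_iso w P (b := false) (c := (j <= k)%N).
  by apply/esym/negbTE; rewrite -ltnNge jk.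
rewrite -[s j]compm1 -ab compmA es; apply: (deflation_iso_r hX) hg.
by exists (step_d w P false (j <= k)%N).
Qed.

Lemma fact_hull_at (X : F) (j : 'I_n) : exists (I : F) (i : fact_hom X I),
  [/\ @projective F FE I, @injective_ob F FE I & inflation E (i j)].
Proof.
have proj_inj := projective_injective hE.
have [I [g [hI hg]]] := enough_injectives hE ((X : factorization n_gt1 w) j).
exists (coind n_gt1 wT j I), (coind_into wT g); split.
- exact/coind_projective/proj_inj.
- exact: coind_injective.
have [|b [ba ab]] := step_d_iso w I (b := (j <= j)%N) (c := true); first exact: leqnn.
rewrite -[coind_into wT g j]comp1m -ba -compmA (coind_intoE wT g).
by apply: (inflation_iso_l hX) hg; exists (step_d w I (j <= j)%N true).
Qed.

(** The covers of the single components are added up one component at a time. *)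
Lemma fact_cover (X : F) : exists (P : F) (p : hom P X),
  [/\ @projective F FE P, @injective_ob F FE P & deflation FE p].
Proof.
suff H m : (m <= n)%N -> exists (P : F) (p : fact_hom P X),
    [/\ @projective F FE P, @injective_ob F FE P
      & forall j : 'I_n, (j < m)%N -> deflation E (p j)].
  have [P [p [hP hI hp]]] := H n (leqnn n).
  by exists P, p; split=> //; apply: (fact_deflation T_add T_equiv hX) => j; apply: hp.
elim: m => [_|m IH mn].
  have [[Z hZ] _] := exact_additive hFX.
  by exists Z, (0 : @hom F Z X); split=> //; [apply: zero_projective|apply: zero_injective].
have [P [p [hP hI hp]]] := IH (ltnW mn).
have [Q [q [hQ hJ hq]]] := fact_cover_at X (Ordinal mn).
have [S [i1 [i2 [p1 [p2 hb]]]]] := (exact_additive hFX).2 P Q.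
exists S, ((p : @hom F P X) \oc p1 + (q : @hom F Q X) \oc p2); split.
- exact: biproduct_projective hb hP hQ.
- exact: biproduct_injective hb hI hJ.
move=> j; rewrite ltnS leq_eqVlt => /orP [/eqP jm|/hp hpj].
  have -> : j = Ordinal mn by apply: ord_inj.
  have := deflation_copair hX (p (Ordinal mn)) (is_biproduct_sym (fact_biproduct_at (Ordinal mn) hb)) hq.
  by rewrite addrC.
exact: (deflation_copair hX (q j) (fact_biproduct_at j hb) hpj).
Qed.

Lemma fact_hull (X : F) : exists (I : F) (i : hom X I),
  [/\ @projective F FE I, @injective_ob F FE I & inflation FE i].
Proof.
suff H m : (m <= n)%N -> exists (I : F) (i : fact_hom X I),
    [/\ @projective F FE I, @injective_ob F FE I
      & forall j : 'I_n, (j < m)%N -> inflation E (i j)].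
  have [I [i [hP hI hi]]] := H n (leqnn n).
  by exists I, i; split=> //; apply: (fact_inflation T_add hX) => j; apply: hi.
elim: m => [_|m IH mn].
  have [[Z hZ] _] := exact_additive hFX.
  by exists Z, (0 : @hom F X Z); split=> //; [apply: zero_projective|apply: zero_injective].
have [P [p [hP hI hp]]] := IH (ltnW mn).
have [Q [q [hQ hJ hq]]] := fact_hull_at X (Ordinal mn).
have [S [i1 [i2 [p1 [p2 hb]]]]] := (exact_additive hFX).2 P Q.
exists S, (i1 \oc (p : @hom F X P) + i2 \oc (q : @hom F X Q)); split.
- exact: biproduct_projective hb hP hQ.
- exact: biproduct_injective hb hI hJ.
move=> j; rewrite ltnS leq_eqVlt => /orP [/eqP jm|/hp hpj].
  have -> : j = Ordinal mn by apply: ord_inj.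
  have := inflation_pair hX (p (Ordinal mn)) (is_biproduct_sym (fact_biproduct_at (Ordinal mn) hb)) hq.
  by rewrite addrC.
exact: (inflation_pair hX (q j) (fact_biproduct_at j hb) hpj).
Qed.

Lemma fact_is_frobenius : is_frobenius FE.
Proof.
exact: frobenius_of_projective_injective hFX fact_cover fact_hull.
Qed.

End Frobenius.

Theorem corollary4p10 (n : nat) (n_gt1 : (1 < n)%N)
    (A : preadditive) (E : pair_class A) (hE : is_frobenius E)
    (T : functor A A) (T_add : is_additive_functor T) (T_equiv : is_equivalence T)
    (w : nat_trans (id_functor A) T)
    (wT : forall X : A, w (T X) = fmap T (w X)) :
  let FE := fact_exact (n_gt1 := n_gt1) (w := w) (T_add := T_add) E in
  [/\ is_exact FE,
      preserves_reflects_conflations E T -> is_frobenius FE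
    & forall hF : is_frobenius FE,
        exists (S : functor (stable hF) (stable hF)) (sD : cosyzygy_suspension S),
          is_triangulated (stable_triangle sD)].
Proof.
move=> FE; split.
- exact: fact_is_exact (frobenius_exact hE).
- exact: fact_is_frobenius.
- by move=> hF; exists (suspension hF), (suspension_cosyzygy hF); apply: stable_triangulated.
Qed.
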